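(* Let $\beta\in \mathrm{Sym}_n(\mathbb Q)$ be positive semi-definite of rank $n-1$. Then $\Gamma$ acts with finitely many orbits on the set of reduced elements of $\Omega_\beta^s\cap(L^n+h)$, and the (union over $i,j$ of the) sets $\mathcal C_{\beta,i,j}^{red}=\mathcal C_{\beta,i,j}\cap\Omega_\beta^{red}$ form a set of representatives for these orbits.
   Context: $V$ is a $\mathbb Q$-vector space of dimension $p+1$ with a non-degenerate symmetric bilinear form $(\,,)$ of signature $(p,1)$; $L\subset V$ is a $\mathbb Z$-lattice of full rank with $L\subset L^{\#}$ (dual lattice); $1\le n\le p$, $h\in(L^{\#})^n$. $B$ is one component of $\{Z\in V(\mathbb R):(Z,Z)=-1\}$. $G_0(\mathbb R)$ is the identity component of $SO(V)(\mathbb R)$ and $\Gamma$ is a neat subgroup of finite index in the stabilizer of $L$ in $G_0(\mathbb R)$, acting trivially on $L^{\#}/L$; $V$ has nonzero rational isotropic vectors. $\ell_0,\dots,\ell_r$ represent the $\Gamma$-orbits of rational isotropic lines; $\Gamma_j=\Gamma\cap N_j$, where $N_j$ is the unipotent radical of the parabolic subgroup stabilizing $\ell_j$. For $X\in V^n$, $(X,X)=((x_i,x_j))$ and $R(X)$ is the radical of $\mathrm{span}(X)$. $\Omega_\beta^s=\{X\in V^n:\frac12(X,X)=\beta,\ \mathrm{rank}(X)=n\}$. For $X\in\Omega_\beta^s$, $R(X)=\ell_X$ is a rational isotropic line; let $u_X$ be the primitive generator of $\ell_X\cap L$ with $(u_X,Z)<0$ for all $Z\in B$. $X$ is called reduced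 if for one of the two primitive vectors $a\in\mathbb Z^n$ with $\beta a=0$ one has $X\cdot a=\nu(X)u_X$ with $\nu(X)\in[0,1)$ (here $X\cdot a=\sum a_ix_i$); $\Omega_\beta^{red}\subset\Omega_\beta^s$ is the set of reduced elements. Let $\{U_{ij}\}_{i=1}^{a_j}$ be the finite set of subspaces $\mathrm{span}(X)$ with $X\in\Omega_\beta^s\cap(L^n+h)$, $\ell_X=\ell_j$; let $\Omega_{\beta,i,j}=\{X\in\Omega_\beta^s:\mathrm{span}(X)=U_{ij}\}$ and let $\Gamma_{U_{ij}}$ be the subgroup of $\Gamma_j$ acting trivially on $U_{ij}$. $\Gamma_j/\Gamma_{U_{ij}}$ acts freely on $\Omega_{\beta,i,j}\cap(L^n+h)$, and $\mathcal C_{\beta,i,j}$ is a set of orbit representatives for this action. *)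

(* Defs.v *)
From HB Require Import structures.
From mathcomp Require Import all_boot all_order all_algebra all_field.
From mathcomp Require Import all_classical all_reals all_analysis.
Set Implicit Arguments.
Unset Strict Implicit.
Unset Printing Implicit Defensive.
Import Order.TTheory GRing.Theory Num.Theory.
Import numFieldNormedType.Exports.
Local Open Scope classical_set_scope.
Local Open Scope ring_scope.

Definition gram (V : vectType rat) (b : {symmetric V}) (m : nat)
    (X : m.-tuple V) : 'M[rat]_m :=
  \matrix_(i, j) b (tnth X i) (tnth X j).

Definition has_signature (V : vectType rat) (b : {symmetric V}) (p q : nat) :=
  exists e : (\dim {:V}).-tuple V,
    [/\ basis_of fullv e,
        forall i j, i != j -> b (tnth e i) (tnth e j) = 0,
        #|[pred i | 0 < b (tnth e i) (tnth e i)]| = p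
      & #|[pred i | b (tnth e i) (tnth e i) < 0]| = q].

Definition pos_semidefinite (n : nat) (beta : 'M[rat]_n) :=
  beta^T = beta /\ forall x : 'cV[rat]_n, 0 <= (x^T *m beta *m x) 0 0.

(* Coordinates are taken with respect to the fixed rational basis
   vbasis {:V}, so that V(R) is the space of row vectors of length dim V, and
   an endomorphism of V(R) is a matrix acting on rows from the right. *)

Definition mxQ (V : vectType rat) (g : 'End(V)) : 'M[rat]_(\dim {:V}) :=
  passmx.mxof (vbasis {:V}) (vbasis {:V}) g.

Definition vecR (R : realType) (V : vectType rat) (v : V) :
    'rV[R]_(\dim {:V}) :=
  map_mx ratr (passmx.rVof (vbasis {:V}) v).

Definition mxR (R : realType) (V : vectType rat) (g : 'End(V)) :
    'M[R]_(\dim {:V}) :=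
  map_mx ratr (mxQ g).

Definition formR (R : realType) (V : vectType rat) (b : {symmetric V})
    (x y : 'rV[R]_(\dim {:V})) : R :=
  form idfun (map_mx ratr (gram b (vbasis {:V}))) x y.

Definition SO_R (R : realType) (V : vectType rat) (b : {symmetric V}) :
    set 'M[R]_(\dim {:V}) :=
  [set g | (forall x y, formR b (x *m g) (y *m g) = formR b x y)
           /\ \det g = 1].

Definition G0_R (R : realType) (V : vectType rat) (b : {symmetric V}) :
    set 'M[R]_(\dim {:V}) :=
  connected_component (@SO_R R V b) 1%:M.

Definition hyperboloid_component (R : realType) (V : vectType rat)
    (b : {symmetric V}) (B : set 'rV[R]_(\dim {:V})) :=
  exists2 Z0, formR b Z0 Z0 = -1
            & B = connected_component [set Z | formR b Z Z = -1] Z0.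

Definition is_lattice (V : vectType rat) (L : set V) :=
  exists e : (\dim {:V}).-tuple V,
    basis_of fullv e /\
    L = [set v | exists c : 'I_(\dim {:V}) -> int,
                   v = \sum_i tnth e i *~ c i].

Definition dual_lattice (V : vectType rat) (b : {symmetric V}) (L : set V) : set V :=
  [set v | forall x, L x -> b v x \is a Num.int].

Definition is_subgroup (V : vectType rat) (G : set 'End(V)) :=
  [/\ G \1%VF,
      forall g k, G g -> G k -> G (g \o k)%VF
    & forall g, G g -> lker g = 0%VS /\ G (g^-1)%VF].

(* An element of G_0(R) mapping L onto itself maps V = L (x) Q to itself, so
   the stabilizer consists of rational endomorphisms. *)
Definition lattice_stabilizer (R : realType) (V : vectType rat)
    (b : {symmetric V}) (L : set V) : set 'End(V) :=
  [set g : 'End(V) | G0_R b (mxR R g) /\ [set g v | v in L] = L].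

Definition finite_index (V : vectType rat) (H G : set 'End(V)) :=
  exists s : seq 'End(V),
    forall g, G g -> exists t : 'End(V),
      [/\ t \in s, G t & H (t^-1 \o g)%VF].

(* For every element, the subgroup of the nonzero complex numbers generated by
   its eigenvalues is torsion free. *)
Definition neat (V : vectType rat) (G : set 'End(V)) :=
  forall g, G g ->
  forall s : seq algC,
    map_poly ratr (char_poly (mxQ g)) = \prod_(z <- s) ('X - z%:P) ->
  forall (c : 'I_(size s) -> int) (m : nat),
    let z := \prod_(i < size s) exprz s`_i (c i) in
    (0 < m)%N -> z ^+ m = 1 -> z = 1.

Definition isotropic_line (V : vectType rat) (b : {symmetric V})
    (l : {vspace V}) :=
  \dim l = 1%N /\ forall v, v \in l -> b v v = 0.

Definition unipotent (V : vectType rat) (g : 'End(V)) :=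
  exists m, forall v, iter m (fun w => g w - w) v = 0.

(* Rational points of the parabolic subgroup of SO(V) stabilizing l. *)
Definition parabolic (V : vectType rat) (b : {symmetric V})
    (l : {vspace V}) : set 'End(V) :=
  [set g : 'End(V) | [/\ forall v w, b (g v) (g w) = b v w,
                         \det (mxQ g) = 1 & (g @: l)%VS = l]].

(* The largest normal unipotent subgroup; in characteristic 0 a unipotent
   algebraic group is automatically connected. *)
Definition unipotent_radical (V : vectType rat) (P : set 'End(V)) :
    set 'End(V) :=
  [set g | exists N : set 'End(V),
    [/\ is_subgroup N, N `<=` P,
        forall x y, P x -> N y -> N (x \o y \o x^-1)%VF,
        forall y, N y -> unipotent y
      & N g]].

Definition radical (V : vectType rat) (b : {symmetric V}) (U : {vspace V}) :
    {vspace V} :=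
  (U :&: orthov b U)%VS.

Definition act_tuple (V : vectType rat) (n : nat) (g : 'End(V)) (X : n.-tuple V) :
    n.-tuple V :=
  [tuple of map g X].

Definition orbit_of (V : vectType rat) (n : nat) (G : set 'End(V))
    (X : n.-tuple V) : set (n.-tuple V) :=
  [set act_tuple g X | g in G].

Definition orbit_representatives (V : vectType rat) (n : nat)
    (G : set 'End(V)) (S C : set (n.-tuple V)) :=
  C `<=` S /\ forall X, S X -> exists! Y, C Y /\ orbit_of G X Y.

(* L^n + h *)
Definition lattice_coset (V : vectType rat) (n : nat) (L : set V)
    (h : n.-tuple V) : set (n.-tuple V) :=
  [set X | forall i, L (tnth X i - tnth h i)].

Definition Omega_s (V : vectType rat) (b : {symmetric V}) (n : nat)
    (beta : 'M[rat]_n) : set (n.-tuple V) :=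
  [set X | 2^-1 *: gram b X = beta /\ \dim <<X>> = n].

Definition primitive_vector (n : nat) (a : 'cV[int]_n) :=
  \big[gcdn/0%N]_(i < n) `|a i ord0|%N = 1%N.

(* u generates the intersection of l and L and is negative on B; these
   conditions determine u. *)
Definition primitive_generator (R : realType) (V : vectType rat)
    (b : {symmetric V}) (L : set V) (B : set 'rV[R]_(\dim {:V}))
    (l : {vspace V}) (u : V) :=
  [set v | v \in l /\ L v] = [set u *~ k | k in [set: int]] /\
  forall Z, B Z -> formR b (vecR R u) Z < 0.

Definition Omega_red (R : realType) (V : vectType rat) (b : {symmetric V})
    (L : set V) (B : set 'rV[R]_(\dim {:V})) (n : nat) (beta : 'M[rat]_n) :
    set (n.-tuple V) :=
  [set X | Omega_s b beta X /\
    exists (a : 'cV[int]_n) (u : V) (nu : rat),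
      [/\ primitive_vector a, beta *m map_mx intr a = 0,
          primitive_generator b L B (radical b <<X>>) u,
          \sum_i tnth X i *~ a i 0 = nu *: u
        & 0 <= nu < 1]].

(* For l = l_j, these are the subspaces U_ij; the set serves as its own index
   set, so its finiteness is nowhere assumed. *)
Definition spans_at (V : vectType rat) (b : {symmetric V}) (L : set V)
    (n : nat) (h : n.-tuple V) (beta : 'M[rat]_n) (l : {vspace V}) :
    set {vspace V} :=
  [set U | exists X : n.-tuple V,
    [/\ Omega_s b beta X, lattice_coset L h X, radical b <<X>> = l
      & <<X>>%VS = U]].

Definition Omega_span (V : vectType rat) (b : {symmetric V}) (n : nat)
    (beta : 'M[rat]_n) (U : {vspace V}) : set (n.-tuple V) :=
  [set X | Omega_s b beta X /\ <<X>>%VS = U].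

(* Main.v *)
Require Import Defs.
From HB Require Import structures.
From mathcomp Require Import all_boot all_order all_algebra all_field.
From mathcomp Require Import all_classical all_reals all_analysis.
From mathcomp Require Import ring lra zify.
Set Implicit Arguments.
Unset Strict Implicit.
Unset Printing Implicit Defensive.
Import Order.TTheory GRing.Theory Num.Theory.
Import numFieldNormedType.Exports passmx.
Local Open Scope classical_set_scope.
Local Open Scope ring_scope.

(* Let X be reduced with radical l, and let u generate l on the lattice L.

   Representatives. An element of Gamma stabilizing l fixes u, preserves a
   lattice in the definite space l^perp / l, hence acts on it with finite order;
   its eigenvalues are roots of unity, so neatness makes it unipotent, and a
   unipotent isometry of a definite space is trivial. Thus it lies in the
   unipotent radical and preserves every subspace U with l <= U <= l^perp, so two
   Gamma-equivalent tuples of the C_{ij} already are equivalent under Gamma_j for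
   the same span.

   Finiteness. Let X, X' be reduced with the same radical l and congruent modulo
   P times the dual lattice, P large. The form is definite on l^perp / l, so they
   agree there and X' = X + k u with k integral and highly divisible. Reducedness
   bounds X.a and X'.a, so k.a = 0, whence k = 2 beta y for some y, and the
   Eichler transformation attached to u and w = sum y_j x_j maps X to X'. It
   preserves L, so it lies in Gamma up to finite index. *)

(** * Topology of matrices and symmetric forms *)

Lemma continuous_mx (T : topologicalType) (U : topologicalType) m n
    (f : T -> 'M[U]_(m, n)) :
  (forall i j, continuous (fun t => f t i j)) -> continuous f.
Proof.
move=> cf t A [P nP sPA].
have : \forall t' \near t, forall ij : 'I_m * 'I_n, P ij.1 ij.2 (f t' ij.1 ij.2).
  by apply: filter_forall => -[i j]; exact: cf (nP i j).
by apply: filterS => t' Pt'; apply: sPA => i j; exact: (Pt' (i, j)).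
Qed.

Lemma continuous_coord_mx (U : topologicalType) m n (i : 'I_m) (j : 'I_n) :
  continuous (fun M : 'M[U]_(m, n) => M i j).
Proof.
move=> M A nA; exists (fun i' j' => if (i' == i) && (j' == j) then A else setT).
  by move=> i' j'; case: ifP => [/andP[/eqP-> /eqP->]//|_]; exact: filterT.
by move=> N /(_ i j); rewrite !eqxx.
Qed.

Lemma continuous_mulmxl (R : realType) m n (Z : 'rV[R]_m) :
  continuous (fun g : 'M[R]_(m, n) => Z *m g).
Proof.
apply: continuous_mx => i j.
under eq_fun do rewrite mxE.
have addc : continuous (fun x : R * R => x.1 + x.2) by exact: add_continuous.
apply: (@continuous_big R 'I_m +%R 0 xpredT addc _ (index_enum _)
  (fun k (g : 'M[R]_(m, n)) => Z i k * g k j)) => k _ g.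
apply: (@continuousM R _ (fun=> Z i k) (fun g : 'M[R]_(m, n) => g k j) g
  (cvg_cst _) (@continuous_coord_mx R m n k j g)).
exact: (@nbhs_filter 'M[R]_(m, n) g).
Qed.

Lemma connected_component_image (T U : topologicalType) (f : T -> U)
    (A : set T) (A' : set U) x y :
  continuous f -> (forall z, A z -> A' (f z)) ->
  connected_component A x y -> connected_component A' (f x) (f y).
Proof.
move=> cf fAA' [C [Cx CA cC] Cy].
exists (f @` C); last by exists y.
split; first by exists x.
  by move=> _ [z Cz <-]; exact/fAA'/CA.
apply: connected_continuous_connected => //.
exact: continuous_subspaceT.
Qed.

Section SymmetricForm.
Variables (V : vectType rat) (b : {symmetric V}).

Lemma formC v w : b v w = b w v.
Proof. by rewrite hermC expr0 mul1r. Qed.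

Lemma formZl a v w : b (a *: v) w = a * b v w.
Proof. by rewrite linearZl_LR. Qed.

Lemma formZr a v w : b v (a *: w) = a * b v w.
Proof. by rewrite linearZr_LR. Qed.

Lemma formDl u v w : b (u + v) w = b u w + b v w.
Proof. exact: linearDl. Qed.

Lemma formDr u v w : b w (u + v) = b w u + b w v.
Proof. exact: linearDr. Qed.

Lemma formNl v w : b (- v) w = - b v w.
Proof. exact: linearNl. Qed.

Lemma formNr v w : b v (- w) = - b v w.
Proof. exact: linearNr. Qed.

Lemma form0l w : b 0 w = 0.
Proof. exact: linear0l. Qed.

Lemma form_suml I r (P : pred I) F w :
  b (\sum_(i <- r | P i) F i) w = \sum_(i <- r | P i) b (F i) w.
Proof. exact: linear_sumlz. Qed.

Lemma form_sumr I r (P : pred I) F w :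
  b w (\sum_(i <- r | P i) F i) = \sum_(i <- r | P i) b w (F i).
Proof. exact: linear_sumr. Qed.

Definition formE := (formDl, formDr, formNl, formNr, formZl, formZr).

Lemma nondegenerate_eq0 v : nondegenerate b -> (forall w, b v w = 0) -> v = 0.
Proof.
move=> /eqP b0 vw0; apply/eqP; rewrite -memv0 -b0.
by apply/mem_orthovP => w _; apply: vw0.
Qed.

End SymmetricForm.

(** * Eichler transformations *)

Section EichlerMatrix.
Variables (F : numFieldType) (N : nat) (G : 'M[F]_N).
Implicit Types x y u w : 'rV[F]_N.

Definition mxform x y : F := (x *m G *m y^T) 0 0.

Lemma mxformDl x y w : mxform (x + y) w = mxform x w + mxform y w.
Proof. by rewrite /mxform !mulmxDl mxE. Qed.

Lemma mxformZl a x w : mxform (a *: x) w = a * mxform x w.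
Proof. by rewrite /mxform -!scalemxAl mxE. Qed.

Lemma mxformDr x y w : mxform w (x + y) = mxform w x + mxform w y.
Proof. by rewrite /mxform linearD /= mulmxDr mxE. Qed.

Lemma mxformZr a x w : mxform w (a *: x) = a * mxform w x.
Proof. by rewrite /mxform linearZ /= -scalemxAr mxE. Qed.

Lemma mxformNl x w : mxform (- x) w = - mxform x w.
Proof. by rewrite -scaleN1r mxformZl mulN1r. Qed.

Lemma mxformNr x w : mxform w (- x) = - mxform w x.
Proof. by rewrite -scaleN1r mxformZr mulN1r. Qed.

Lemma mxform_delta (A : 'M[F]_N) i j :
  mxform (delta_mx 0 i *m A) (delta_mx 0 j *m A) = (A *m G *m A^T) i j.
Proof.
by rewrite /mxform trmx_mul trmx_delta !mulmxA -colE mxE -!mulmxA -rowE mxE.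
Qed.

Definition mxformE :=
  (mxformDl, mxformDr, mxformNl, mxformNr, mxformZl, mxformZr).

Lemma mxform_mul x u y : x *m (G *m u^T *m y) = mxform x u *: y.
Proof. by rewrite !mulmxA [x *m G *m _]mx11_scalar mul_scalar_mx. Qed.

(* The Siegel-Eichler transformation attached to an isotropic vector u and a
   vector w orthogonal to it. *)
Definition eichler_mx u w : 'M[F]_N :=
  1%:M + G *m w^T *m u - G *m u^T *m w
    - (mxform w w / 2) *: (G *m u^T *m u).

Lemma mul_eichler_mx u w x :
  x *m eichler_mx u w = x + mxform x w *: u - mxform x u *: w
                          - (mxform w w / 2 * mxform x u) *: u.
Proof.
by rewrite !mulmxDr !mulmxN -scalemxAr !mxform_mul mulmx1 scalerA.
Qed.

Hypothesis Gsym : G^T = G.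

Lemma mxformC x y : mxform x y = mxform y x.
Proof.
transitivity ((x *m G *m y^T)^T 0 0); first by rewrite [RHS]mxE.
by rewrite trmx_mul trmxK trmx_mul Gsym mulmxA.
Qed.

Variables (u w : 'rV[F]_N).
Hypotheses (uu : mxform u u = 0) (uw : mxform u w = 0).

Lemma eichler_mx_form x y :
  mxform (x *m eichler_mx u w) (y *m eichler_mx u w) = mxform x y.
Proof.
rewrite !mul_eichler_mx !mxformE uu uw (mxformC w u) uw.
rewrite (mxformC u y) (mxformC w y).
by field.
Qed.

Lemma eichler_mxD s t :
  eichler_mx u (s *: w) *m eichler_mx u (t *: w) = eichler_mx u ((s + t) *: w).
Proof.
apply/row_matrixP => i; rewrite !rowE mulmxA.
rewrite !mul_eichler_mx !mxformE uu uw (mxformC w u) uw.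
move: (delta_mx 0 i) => x; apply/rowP => j; rewrite !mxE.
by field.
Qed.

End EichlerMatrix.

Lemma det_eichler_mx (F : numFieldType) N (G : 'M[F]_N) u w : G^T = G ->
  mxform G u u = 0 -> mxform G u w = 0 -> \det G != 0 ->
  \det (eichler_mx G u w) = 1.
Proof.
move=> Gsym uu uw G0; set M := eichler_mx G u (2^-1 *: w).
have uw2 : mxform G u (2^-1 *: w) = 0 by rewrite mxformZr uw mulr0.
have MG : M *m G *m M^T = G.
  apply/matrixP => i j.
  rewrite -mxform_delta eichler_mx_form // -{1}[delta_mx 0 i]mulmx1.
  by rewrite -[delta_mx 0 j]mulmx1 mxform_delta trmx1 mulmx1 mul1mx.
have : \det M * \det M = 1.
  by apply: (mulIf G0); rewrite mul1r -{2}MG !det_mulmx det_tr mulrAC.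
rewrite -det_mulmx eichler_mxD // => <-; congr (\det (eichler_mx G u _)).
by rewrite -{1}[w]scale1r; congr (_ *: _); field.
Qed.

Section Eichler.
Variables (V : vectType rat) (b : {symmetric V}).
Local Notation N := (\dim {:V}).
Local Notation e := (vbasis {:V}).
Local Notation G := (gram b e).

Let eB : basis_of fullv e := vbasisP _.

Lemma gram_sym n (X : n.-tuple V) : (gram b X)^T = gram b X.
Proof. by apply/matrixP => i j; rewrite !mxE formC. Qed.

Lemma mxform_rVof v w : mxform G (rVof e v) (rVof e w) = b v w.
Proof.
rewrite -{2}(rVofK eB v) -{2}(rVofK eB w) /vecof.
rewrite /mxform mxE form_sumr; apply: eq_bigr => j _.
rewrite formZr form_suml mxE mulr_suml mulr_sumr; apply: eq_bigr => i _.
by rewrite formZl !mxE !(tnth_nth 0) mulrC.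
Qed.

Lemma det_gram : nondegenerate b -> \det G != 0.
Proof.
move=> b_nondeg; apply/det0P => -[r r0 rG]; case/negP: r0.
have -> : r = rVof e (vecof e r) by rewrite vecofK.
rewrite rVof_eq0 //; apply/eqP/(nondegenerate_eq0 b_nondeg) => w.
by rewrite -mxform_rVof vecofK // /mxform rG mul0mx mxE.
Qed.

Definition eichler u w : 'End(V) :=
  hommx e e (eichler_mx G (rVof e u) (rVof e w)).

Lemma eichlerE u w v :
  eichler u w v = v + b v w *: u - b v u *: w - (b w w / 2 * b v u) *: u.
Proof.
rewrite /eichler (hommxE eB eB) mul_eichler_mx !mxform_rVof.
apply: (can_inj (rVofK eB)).
by rewrite (vecofK eB) !linearB linearD !linearZ.
Qed.

Lemma formRE (R : realType) : @formR R V b =2 mxform (map_mx ratr G).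
Proof.
move=> x y; rewrite /formR /form /mxform; congr ((_ *m _) 0 0).
by apply/matrixP => i j; rewrite !mxE.
Qed.

Lemma formR_vecR (R : realType) v w :
  formR b (@vecR R V v) (@vecR R V w) = ratr (b v w).
Proof.
by rewrite formRE -mxform_rVof /mxform /vecR map_trmx -!map_mxM mxE.
Qed.

Lemma mxR_eichler (R : realType) u w :
  @mxR R V (eichler u w) =
  eichler_mx (map_mx ratr G) (@vecR R V u) (@vecR R V w).
Proof.
rewrite /mxR /mxQ /eichler hommxK // /eichler_mx.
rewrite -(formRE (vecR R w) (vecR R w)) formR_vecR mxform_rVof.
rewrite !(map_mxD, map_mxN, map_mxZ, map_mxM) map_mx1 !map_trmx.
by rewrite fmorph_div rmorph_nat.
Qed.

Lemma continuous_eichler_mx (R : realType) (H : 'M[R]_N) (u w : 'rV[R]_N) :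
  continuous (fun t : R => eichler_mx H u (t *: w)).
Proof.
apply: continuous_mx => i j.
pose p := (1%:M i j)%:P + ((H *m w^T *m u - H *m u^T *m w) i j) *: 'X
  - (mxform H w w / 2 * (H *m u^T *m u) i j) *: 'X^2 : {poly R}.
have -> : (fun t => eichler_mx H u (t *: w) i j) = fun t => p.[t].
  apply/funext => t; rewrite /p !hornerE /eichler_mx.
  have -> : (t *: w)^T = t *: w^T by exact: linearZ.
  by rewrite mxformZl mxformZr -!scalemxAr -scalemxAl !mxE /=; ring.
exact: continuous_horner.
Qed.

Lemma eichler_G0 (R : realType) u w : nondegenerate b -> b u u = 0 ->
  b u w = 0 -> G0_R b (@mxR R V (eichler u w)).
Proof.
move=> b_nondeg uu uw.
set H := map_mx (@ratr R) G.
have Hsym : H^T = H by rewrite /H map_trmx gram_sym.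
have H0 : \det H != 0 by rewrite det_map_mx fmorph_eq0 det_gram.
have uuR : mxform H (vecR R u) (vecR R u) = 0 by rewrite -formRE formR_vecR uu rmorph0.
have uwR : mxform H (vecR R u) (vecR R w) = 0 by rewrite -formRE formR_vecR uw rmorph0.
pose path t := eichler_mx H (vecR R u) (t *: vecR R w).
have -> : mxR R (eichler u w) = path 1 by rewrite mxR_eichler /path scale1r.
rewrite /G0_R.
have -> : 1%:M = path 0.
  rewrite /path /eichler_mx scale0r trmx0 !mulmx0 mul0mx addr0 subr0.
  by rewrite /mxform !mul0mx mxE mul0r scale0r subr0.
have uwt t : mxform H (vecR R u) (t *: vecR R w) = 0.
  by rewrite mxformZr uwR mulr0.
apply: (@connected_component_image _ _ path setT).
- exact: continuous_eichler_mx.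
- move=> t _; split; last by rewrite det_eichler_mx.
  by move=> x y; rewrite !formRE eichler_mx_form.
- exists setT => //; split => //; apply/connected_intervalP.
  by move=> ? ? ? ? ?.
Qed.

End Eichler.

(** * Real points *)

Section RealPoints.
Variables (R : realType) (V : vectType rat) (b : {symmetric V}).
Local Notation N := (\dim {:V}).
Local Notation e := (vbasis {:V}).
Local Notation vecR := (@vecR R V).
Local Notation mxR := (@mxR R V).

Let eB : basis_of fullv e := vbasisP _.

Lemma vecR_app (g : 'End(V)) v : vecR (g v) = vecR v *m mxR g.
Proof. by rewrite /vecR (rVof_app _ eB) map_mxM. Qed.

Lemma mxR_comp (g k : 'End(V)) : mxR (g \o k)%VF = mxR k *m mxR g.
Proof. by rewrite /mxR /mxQ (mxof_comp _ _ eB) map_mxM. Qed.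

Lemma mxR1 : mxR \1%VF = 1%:M.
Proof. by rewrite /mxR /mxQ mxof1 ?map_mx1 // (basis_free eB). Qed.

Lemma SO_R_form (g : 'End(V)) : SO_R b (mxR g) -> forall v w, b (g v) (g w) = b v w.
Proof.
move=> [gb _] v w; have := gb (vecR v) (vecR w).
by rewrite -!vecR_app !formR_vecR => /fmorph_inj.
Qed.

Lemma SO_R_det (g : 'End(V)) : SO_R b (mxR g) -> \det (mxQ g) = 1.
Proof.
by move=> [_]; rewrite det_map_mx -[1](rmorph1 (@ratr R)) => /fmorph_inj.
Qed.

Lemma G0_R_SO g : G0_R b g -> @SO_R R V b g.
Proof. exact: connected_component_sub. Qed.

Lemma G0_R_component (B : set 'rV[R]_N) g Z :
  hyperboloid_component b B -> G0_R b g -> B Z -> B (Z *m g).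
Proof.
move=> [Z0 Z0h ->] Gg BZ.
apply: (connected_component_trans BZ).
have Zh := connected_component_sub BZ.
rewrite -{1}[Z]mulmx1.
apply: (@connected_component_image _ _ (mulmx Z) _ _ _ _ _ _ Gg) => //.
  exact: continuous_mulmxl.
by move=> k [kb _] /=; rewrite kb.
Qed.

End RealPoints.

(** * Lorentzian forms and lattices *)

Section Lorentzian.
Variables (V : vectType rat) (b : {symmetric V}) (p : nat).
Hypotheses (dimV : \dim {:V} = p.+1) (b_sign : has_signature b p 1).

(* One coordinate functional carries the whole negative part of the form. *)
Lemma negative_coordinate : exists2 f : V -> rat,
    (forall a v w, f (a *: v + w) = a * f v + f w) &
    (forall v, f v = 0 -> 0 <= b v v /\ (b v v = 0 -> v = 0)).
Proof.
have [e [eB e_orth e_pos e_neg]] := b_sign.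
have [i0 i0_neg] : exists i0, b (tnth e i0) (tnth e i0) < 0.
  have /card_gt0P[i0 i0P] : (0 < #|[pred i | (b (tnth e i) (tnth e i) < 0)%R]|)%N.
    by rewrite e_neg.
  by exists i0; move: i0P; rewrite inE.
have pos i : i != i0 -> 0 < b (tnth e i) (tnth e i).
  move=> ii0.
  have sub : [pred i | 0 < b (tnth e i) (tnth e i)] \subset predC1 i0.
    apply/fintype.subsetP => j; rewrite !inE; apply: contraTneq => ->.
    by rewrite lt_gtF.
  have /subset_cardP/(_ sub) H : #|[pred i | 0 < b (tnth e i) (tnth e i)]| = #|predC1 i0|.
    by rewrite e_pos cardC1 card_ord dimV.
  by have := H i; rewrite !inE ii0.
exists (fun v => coord e i0 v) => [a v w|v v0].
  by rewrite linearP.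
have bv : b v v = \sum_i coord e i v ^+ 2 * b (tnth e i) (tnth e i).
  rewrite {1 2}(coord_basis eB (memvf v)) form_suml; apply: eq_bigr => i _.
  rewrite form_sumr (bigD1 i) //= big1 => [|j ji].
    by rewrite !formE -tnth_nth; ring.
  by rewrite !formE -!tnth_nth e_orth 1?eq_sym // !mulr0.
have term_ge0 i : 0 <= coord e i v ^+ 2 * b (tnth e i) (tnth e i).
  have [->|/pos/ltW di] := eqVneq i i0; first by rewrite v0 expr0n mul0r.
  by rewrite mulr_ge0 ?sqr_ge0.
split=> [|bv0]; first by rewrite bv sumr_ge0.
rewrite (coord_basis eB (memvf v)) big1 // => i _.
have [->|ii0] := eqVneq i i0; first by rewrite v0 scale0r.
have : coord e i v ^+ 2 * b (tnth e i) (tnth e i) = 0.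
  apply/eqP; move: bv0; rewrite bv => /eqP; rewrite psumr_eq0 // => /allP/(_ i).
  by rewrite mem_index_enum => /(_ isT).
move/eqP; rewrite mulf_eq0 (gt_eqF (pos _ ii0)) orbF sqrf_eq0 => /eqP ->.
by rewrite scale0r.
Qed.

Variable u : V.
Hypotheses (u0 : u != 0) (uu : b u u = 0).

Lemma perp_isotropic v : b v u = 0 -> 0 <= b v v /\ (b v v = 0 -> v \in <[u]>%VS).
Proof.
move=> vu; have [f f_lin f_pos] := negative_coordinate.
have fu : f u != 0.
  by apply/eqP => /f_pos[_ /(_ uu)] /eqP; apply/negP.
pose y := (- (f v / f u)) *: u + v.
have fy : f y = 0 by rewrite f_lin mulNr divfK // addNr.
have byy : b y y = b v v by rewrite /y !formE (formC b u v) uu vu; ring.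
have [y_ge0 y_eq0] := f_pos _ fy; rewrite -byy; split=> // /y_eq0 y0.
have -> : v = (f v / f u) *: u.
  by apply/eqP; rewrite -subr_eq0 -scaleNr addrC -/y y0.
exact: memvZ (memv_line u).
Qed.

Lemma perp_cauchy_schwarz v w : b v u = 0 -> b w u = 0 ->
  b v w ^+ 2 <= b v v * b w w.
Proof.
move=> vu wu; have [w_ge0 w_eq0] := perp_isotropic wu.
have [/w_eq0/vlineP[k ->]|w0] := eqVneq (b w w) 0.
  by rewrite !formE vu uu !mulr0 expr0n.
have w_gt0 : 0 < b w w by rewrite lt_neqAle eq_sym w0.
have [] := @perp_isotropic (b w w *: v - b v w *: w); first by rewrite !formE vu wu; ring.
have -> : b (b w w *: v - b v w *: w) (b w w *: v - b v w *: w) =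
          b w w * (b v v * b w w - b v w ^+ 2).
  by rewrite !formE (formC b w v); ring.
by rewrite pmulr_rge0 // subr_ge0.
Qed.

Lemma perp_norm_sub v w : b v u = 0 -> b w u = 0 ->
  b (v - w) (v - w) <= 2 * b v v + 2 * b w w.
Proof.
move=> vu wu; have [] := @perp_isotropic (v + w); first by rewrite formDl vu wu addr0.
by rewrite !formE (formC b w v) => H _; lra.
Qed.

End Lorentzian.

Lemma common_denominator (I : finType) (s : I -> rat) :
  exists2 N : nat, (0 < N)%N & forall i, N%:R * s i \is a Num.int.
Proof.
exists (\prod_i `|denq (s i)|)%N => [|i].
  by rewrite prodn_gt0 // => i; rewrite absz_gt0 denq_eq0.
rewrite (bigD1 i) //= natrM mulrAC.
have -> : `|denq (s i)|%:R * s i = (numq (s i))%:~R.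
  rewrite -{2}(divq_num_den (s i)) natr_absz gtr0_norm ?denq_gt0 //.
  by rewrite mulrC divfK // intr_eq0 denq_eq0.
by rewrite rpredM ?intr_int ?natr_int.
Qed.

Section Lattice.
Variables (V : vectType rat) (L : set V).
Hypothesis (L_lattice : is_lattice L).

Lemma latticeD v w : L v -> L w -> L (v + w).
Proof.
have [e [_ ->]] := L_lattice => -[c ->] [d ->]; exists (fun i => c i + d i).
by rewrite -big_split; apply: eq_bigr => i _; rewrite mulrzDr.
Qed.

Lemma latticeMz v k : L v -> L (v *~ k).
Proof.
have [e [_ ->]] := L_lattice => -[c ->]; exists (fun i => c i * k).
by rewrite mulrz_suml; apply: eq_bigr => i _; rewrite mulrzA.
Qed.

Lemma latticeN v : L v -> L (- v).
Proof. by move=> Lv; rewrite -[v]mulr1z -mulrNz; apply: latticeMz. Qed.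

Lemma latticeB v w : L v -> L w -> L (v - w).
Proof. by move=> Lv Lw; apply: latticeD => //; apply: latticeN. Qed.

Lemma lattice0 : L 0.
Proof.
have [e [_ ->]] := L_lattice; exists (fun=> 0).
by rewrite big1 // => i _; rewrite mulr0z.
Qed.

Lemma lattice_sum I (r : seq I) (P : pred I) F :
  (forall i, P i -> L (F i)) -> L (\sum_(i <- r | P i) F i).
Proof.
by move=> LF; apply: big_ind => //; [exact: lattice0 | exact: latticeD].
Qed.

Lemma latticeZ_int a v : a \is a Num.int -> L v -> L (a *: v).
Proof. by move=> /intrP[k ->] Lv; rewrite scaler_int; apply: latticeMz. Qed.

Lemma lattice_multiple (I : finType) (F : I -> V) :
  exists2 N : nat, (0 < N)%N & forall i, L (N%:R *: F i).
Proof.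
have [e [eB ->]] := L_lattice.
have [N N0 NF] := common_denominator (fun ij : I * _ => coord e ij.2 (F ij.1)).
exists N => // i; exists (fun j => Num.floor (N%:R * coord e j (F i))).
rewrite {1}(coord_basis eB (memvf (F i))) scaler_sumr; apply: eq_bigr => j _.
by rewrite scalerA -tnth_nth -scaler_int floorK // (NF (i, j)).
Qed.

End Lattice.

(** * Neat elements *)

Section UnipotentMatrix.
Variables (d : nat) (A : 'M[rat]_d).
Local Notation Ac := (map_mx (@ratr algC) A).

Lemma eigenvalue_quasi_unipotent N (z : algC) :
  (A - 1%:M) *m (iter N (mulmx A) 1%:M - 1%:M) *m (A - 1%:M) = 0 ->
  root (map_poly ratr (char_poly A)) z -> z ^+ N = 1.
Proof.
rewrite map_char_poly => A0; rewrite -eigenvalue_root_char => /eigenvalueP[v vA v0].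
have vAN k : v *m map_mx ratr (iter k (mulmx A) 1%:M) = z ^+ k *: v.
  elim: k => [|k IH]; first by rewrite map_mx1 mulmx1 expr0 scale1r.
  by rewrite iterS map_mxM mulmxA vA -scalemxAl IH scalerA exprS.
have /eqP : ((z - 1) * (z ^+ N - 1) * (z - 1)) *: v = 0.
  transitivity (v *m map_mx ratr ((A - 1%:M) *m (iter N (mulmx A) 1%:M - 1%:M)
                                    *m (A - 1%:M))).
    have vA1 : v *m (Ac - 1%:M) = (z - 1) *: v.
      by rewrite mulmxBr vA mulmx1 scalerBl scale1r.
    have -> : map_mx ratr ((A - 1%:M) *m (iter N (mulmx A) 1%:M - 1%:M) *m (A - 1%:M)) =
      (Ac - 1%:M) *m (map_mx ratr (iter N (mulmx A) 1%:M) - 1%:M) *m (Ac - 1%:M).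
      by rewrite !(map_mxM, map_mxB, map_mx1).
    have vAN1 : v *m (map_mx ratr (iter N (mulmx A) 1%:M) - 1%:M) = (z ^+ N - 1) *: v.
      by rewrite mulmxBr vAN mulmx1 scalerBl scale1r.
    rewrite !mulmxA vA1 -!scalemxAl vAN1 -scalemxAl vA1 !scalerA.
    by congr (_ *: _); ring.
  by rewrite A0 map_mx0 mulmx0.
rewrite scaler_eq0 (negPf v0) orbF !mulf_eq0 !subr_eq0.
by case/orP => [/orP[]|] /eqP -> //; rewrite expr1n.
Qed.

Lemma unipotent_mx :
  (forall z : algC, root (map_poly ratr (char_poly A)) z -> z = 1) ->
  exists m, forall r, iter m (fun r : 'rV_d => r *m A - r) r = 0.
Proof.
move=> A1; have [s sE] := closed_field_poly_normal (map_poly (@ratr algC) (char_poly A)).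
have s1 z : z \in s -> z = 1.
  move=> zs; apply: A1; rewrite sE rootZ ?root_prod_XsubC //.
  by rewrite lead_coef_map fmorph_eq0 (monicP (char_poly_monic A)) oner_neq0.
have {}sE : char_poly A = ('X - 1%:P) ^+ size s.
  apply: (map_inj_poly (fmorph_inj (@ratr algC)) (rmorph0 _)).
  rewrite sE lead_coef_map (monicP (char_poly_monic A)) rmorph1 scale1r.
  rewrite rmorphXn rmorphB /= map_polyX map_polyC /= rmorph1.
  rewrite (eq_big_seq (fun=> 'X - 1%:P)) => [|z /s1 ->//].
  by rewrite big_const_seq count_predT -Monoid.iteropE.
exists (size s) => r; case: d A sE r => [|d'] A' sE r.
  by apply/rowP => -[].
suff H m (r' : 'rV_d'.+1) : iter m (fun r => r *m A' - r) r' =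
    r' *m horner_mx A' (('X - 1%:P) ^+ m).
  by rewrite H -sE Cayley_Hamilton mulmx0.
elim: m r' => [|m IH] r'; first by rewrite expr0 rmorph1 mulmx1.
rewrite iterSr IH exprS rmorphM /= -[_ * _]/(_ *m _) mulmxA; congr (_ *m _).
by rewrite rmorphB /= horner_mx_X horner_mx_C mulmxBr mulmx1.
Qed.

End UnipotentMatrix.

Lemma rVof_iter (V : vectType rat) (g : 'End(V)) N v :
  rVof (vbasis {:V}) (iter N g v) =
  rVof (vbasis {:V}) v *m iter N (mulmx (mxQ g)) 1%:M.
Proof.
elim: N v => [|N IH] v; first by rewrite mulmx1.
by rewrite iterSr IH (rVof_app _ (vbasisP _)) iterS mulmxA.
Qed.

Lemma neat_quasi_unipotent (V : vectType rat) (Gam : set 'End(V)) g N :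
  neat Gam -> Gam g -> (0 < N)%N ->
  (forall v, let x := g v - v in let y := iter N g x - x in g y = y) ->
  unipotent g.
Proof.
move=> Gam_neat Gg N0 gN.
have eB := vbasisP {:V}.
have A0 : (mxQ g - 1%:M) *m (iter N (mulmx (mxQ g)) 1%:M - 1%:M) *m (mxQ g - 1%:M) = 0.
  apply/row_matrixP => i; rewrite row0 rowE.
  rewrite !mulmxA; move: (delta_mx 0 i) => r.
  rewrite -[r](vecofK eB); set v := vecof _ r.
  have subE w (M : 'M[rat]_(\dim {:V})) w' :
      rVof (vbasis {:V}) w' = rVof (vbasis {:V}) w *m M ->
      rVof (vbasis {:V}) w *m (M - 1%:M) = rVof (vbasis {:V}) (w' - w).
    by move=> h; rewrite mulmxBr mulmx1 -h linearB.
  rewrite (subE _ _ (g v)); last exact: rVof_app.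
  rewrite (subE _ _ (iter N g (g v - v))); last exact: rVof_iter.
  rewrite (subE _ _ (g (iter N g (g v - v) - (g v - v)))); last exact: rVof_app.
  by rewrite (gN v) subrr linear0.
have [s sE] := closed_field_poly_normal (map_poly (@ratr algC) (char_poly (mxQ g))).
rewrite lead_coef_map (monicP (char_poly_monic _)) rmorph1 scale1r in sE.
have z1 (z : algC) : root (map_poly ratr (char_poly (mxQ g))) z -> z = 1.
  move=> rz; have zN := eigenvalue_quasi_unipotent A0 rz.
  have zs : (index z s < size s)%N by rewrite index_mem -root_prod_XsubC -sE.
  have := Gam_neat _ Gg s sE (fun i => (i == Ordinal zs)%:Z) N => /=.
  rewrite (bigD1 (Ordinal zs)) //= eqxx expr1z big1 => [|i /negPf -> //].
  rewrite mulr1 nth_index; first by apply.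
  by rewrite -root_prod_XsubC -sE.
have [m mP] := unipotent_mx z1; exists m => v.
apply: (can_inj (rVofK eB)); rewrite linear0 -(mP (rVof (vbasis {:V}) v)).
elim: m {mP} => // m IH.
by rewrite !iterS linearB -IH /= (rVof_app _ eB).
Qed.

(** * Isometries fixing an isotropic vector *)

Section Residues.
Variable P : nat.

Definition residue (q : rat) : 'I_P.+1 := inord `|(Num.floor q %% P.+1)%Z|%N.

Lemma residue_eq q q' : q \is a Num.int -> q' \is a Num.int ->
  residue q = residue q' -> exists m : int, q - q' = m%:~R * P.+1%:R.
Proof.
move=> /intrP[m ->] /intrP[k ->]; rewrite /residue !intrKfloor => /(congr1 val) /=.
have lt_mod (i : int) : (`|(i %% P.+1)%Z|%N < P.+1)%N.
  by rewrite -ltz_nat gez0_abs ?modz_ge0 // ltz_pmod.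
rewrite !inordK // => /(congr1 Posz); rewrite !gez0_abs ?modz_ge0 // => mk.
exists ((m %/ P.+1)%Z - (k %/ P.+1)%Z).
rewrite {1}(divz_eq m P.+1) {1}(divz_eq k P.+1) mk.
by rewrite !(rmorphD, rmorphB, rmorphM) /=; ring.
Qed.

End Residues.

Section Isotropic.
Variables (V : vectType rat) (b : {symmetric V}) (p : nat) (L : set V).
Hypotheses (dimV : \dim {:V} = p.+1) (b_sign : has_signature b p 1).
Hypothesis L_lattice : is_lattice L.
Variable u : V.
Hypotheses (u0 : u != 0) (uu : b u u = 0).

Lemma perp_lattice_basis : exists2 y : (\dim (orthov b <[u]>)).-tuple V,
    (forall i, L (tnth y i) /\ b (tnth y i) u = 0) &
    (forall z, b z u = 0 -> z \in <<y>>%VS).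
Proof.
pose f := vbasis (orthov b <[u]>).
have [N N0 NL] := lattice_multiple L_lattice (tnth f).
exists [tuple N%:R *: tnth f i | i < _] => [i|z zu].
  rewrite tnth_mktuple; split=> //; rewrite formZl.
  have /mem_orthovP/(_ _ (memv_line u)) -> : tnth f i \in orthov b <[u]>.
    by apply: vbasis_mem; exact: mem_tnth.
  by rewrite mulr0.
have zo : z \in orthov b <[u]> by rewrite mem_orthov1 zu.
rewrite (coord_vbasis zo) memv_suml // => i _; rewrite memvZ //.
have N0' : N%:R != 0 :> rat by rewrite pnatr_eq0 -lt0n.
have -> : f`_i = N%:R^-1 *: tnth [tuple N%:R *: tnth f i | i < _] i.
  by rewrite tnth_mktuple scalerA mulVf // scale1r -tnth_nth.
by rewrite memvZ // memv_span // mem_tnth.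
Qed.

Lemma perp_lattice_separated c : exists P : nat, forall z, b z u = 0 ->
  b z z <= c -> (forall y, L y -> exists m : int, b z y = m%:~R * P.+1%:R) ->
  z \in <[u]>%VS.
Proof.
have [y yL y_span] := perp_lattice_basis.
pose S := \sum_i `|c| * b (tnth y i) (tnth y i).
have y_ge0 i : 0 <= b (tnth y i) (tnth y i).
  by have [_ /(perp_isotropic dimV b_sign u0 uu)[]] := yL i.
have S_ge i : `|c| * b (tnth y i) (tnth y i) <= S.
  by rewrite /S (bigD1 i) //= lerDl sumr_ge0 // => j _; rewrite mulr_ge0.
exists (Num.bound S) => z zu zc zP; set P := (Num.bound S).+1%:R : rat.
have zy i : b z (tnth y i) = 0.
  have [/zP[m zm] yu] := yL i.
  have [m0|m0] := eqVneq m 0; first by rewrite zm m0 mul0r.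
  have m2 : 1 <= m%:~R * m%:~R :> rat by rewrite -intrM ler1z; nia.
  have := perp_cauchy_schwarz dimV b_sign u0 uu zu yu.
  have SP : S < P.
    apply: lt_le_trans (archi_boundP _) _; last by rewrite ler_nat.
    by rewrite sumr_ge0 // => j _; rewrite mulr_ge0.
  have P1 : 1 <= P by rewrite ler1n.
  have := S_ge i; have := y_ge0 i; have := ler_norm c.
  move: (b (tnth y i) _) => t; rewrite zm -/P => cc t0 tS mPz.
  have : b z z * t <= `|c| * t by rewrite ler_wpM2r // (le_trans zc).
  by nra.
apply: (perp_isotropic dimV b_sign u0 uu zu).2.
rewrite {2}(coord_span (y_span _ zu)) form_sumr big1 // => i _.
by rewrite formZr -tnth_nth zy mulr0.
Qed.

Hypotheses (b_nondeg : nondegenerate b) (L_dual : L `<=` dual_lattice b L).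

Section Isometry.
Variable g : 'End(V).
Hypotheses (g_iso : forall v w, b (g v) (g w) = b v w).

Lemma isometry_inj : lker g = 0%VS.
Proof.
apply/eqP; rewrite -subv0; apply/subvP => v; rewrite memv_ker memv0 => /eqP gv.
by apply/eqP/(nondegenerate_eq0 b_nondeg) => w; rewrite -g_iso gv form0l.
Qed.

Lemma isometry_K : cancel g (g^-1)%VF.
Proof. by apply: lker0_lfunK; rewrite isometry_inj. Qed.

Lemma isometry_VK : cancel (g^-1)%VF g.
Proof. by apply: lker0_lfunVK; rewrite isometry_inj. Qed.

Lemma isometry_inv v w : b ((g^-1)%VF v) ((g^-1)%VF w) = b v w.
Proof. by rewrite -g_iso !isometry_VK. Qed.

Lemma isometry_iter m v w : b (iter m g v) (iter m g w) = b v w.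
Proof. by elim: m => //= m IH; rewrite g_iso. Qed.

Hypotheses (gu : g u = u).

Lemma isometry_perp v : b (g v) u = b v u.
Proof. by rewrite -{1}gu g_iso. Qed.

Lemma isometry_perp_iter m v : b (iter m g v) u = b v u.
Proof. by elim: m => //= m IH; rewrite isometry_perp. Qed.

Lemma iter_line m k : iter m g (k *: u) = k *: u.
Proof. by elim: m => //= m ->; rewrite linearZ /= gu. Qed.

Lemma iterB m v w : iter m g (v - w) = iter m g v - iter m g w.
Proof. by elim: m => //= m ->; rewrite linearB. Qed.

(* The images of a lattice basis of the orthogonal complement of u have bounded
   norm, hence only finitely many classes modulo the line of u. *)
Lemma finite_order_perp : [set g v | v in L] `<=` L ->
  exists2 N : nat, (0 < N)%N &
    forall v, b v u = 0 -> iter N g v - v \in <[u]>%VS.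
Proof.
move=> gL.
have iterL m v : L v -> L (iter m g v).
  by move=> Lv; elim: m => //= m IH; apply: gL; exists (iter m g v).
have [y yL y_span] := perp_lattice_basis.
pose S := \sum_i b (tnth y i) (tnth y i).
have y_ge0 i : 0 <= b (tnth y i) (tnth y i).
  by have [_ /(perp_isotropic dimV b_sign u0 uu)[]] := yL i.
have y_le i : b (tnth y i) (tnth y i) <= S.
  by rewrite /S (bigD1 i) //= lerDl sumr_ge0.
have [P sep] := perp_lattice_separated (4 * S).
have [e [eB eL]] := L_lattice.
have Le i : L (tnth e i).
  rewrite eL; exists (fun j => (j == i)%:Z); rewrite (bigD1 i) //= eqxx mulr1z.
  by rewrite big1 ?addr0 // => j /negPf ->.
pose D (m : nat) := [ffun ij : 'I_(\dim (orthov b <[u]>)) * 'I_(\dim {:V}) =>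
  residue P (b (iter m g (tnth y ij.1)) (tnth e ij.2))].
have [m [m' mm' Dmm']] : exists m, exists2 m' : nat, (m < m')%N & D m = D m'.
  apply: contrapT => H.
  pose T := {ffun 'I_(\dim (orthov b <[u]>)) * 'I_(\dim {:V}) -> 'I_P.+1}.
  have Dinj : injective (fun i : 'I_(#|{: T}|).+1 => D i : T).
    move=> i j Dij; apply/val_inj; case: (ltngtP i j) => // ij; case: H.
      by exists i, j.
    by exists j, i.
  by have := leq_card _ Dinj; rewrite card_ord ltnn.
have close i z : L z -> exists k : int,
    b (iter m g (tnth y i) - iter m' g (tnth y i)) z = k%:~R * P.+1%:R.
  rewrite eL => -[c ->].
  have ck j : exists k : int,
      b (iter m g (tnth y i) - iter m' g (tnth y i)) (tnth e j) = k%:~R * P.+1%:R.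
    rewrite formDl formNl; apply: residue_eq; last first.
    - by have /ffunP/(_ (i, j)) := Dmm'; rewrite !ffunE.
    - by apply: L_dual => //; apply: iterL; case: (yL i).
    - by apply: L_dual => //; apply: iterL; case: (yL i).
  have /choice[k kP] := ck; exists (\sum_j k j * c j).
  rewrite form_sumr rmorph_sum mulr_suml; apply: eq_bigr => j _.
  by rewrite -scaler_int formZr kP rmorphM /=; ring.
exists (m' - m)%N => [|v vu]; first by rewrite subn_gt0.
have fix_y i : iter (m' - m) g (tnth y i) - tnth y i \in <[u]>%VS.
  have [_ yu] := yL i.
  have : iter m g (tnth y i) - iter m' g (tnth y i) \in <[u]>%VS.
    apply: sep => [|| z Lz]; last exact: close.
      by rewrite formDl formNl !isometry_perp_iter yu subrr.
    apply: le_trans (perp_norm_sub dimV b_sign u0 uu _ _) _.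
    - by rewrite isometry_perp_iter.
    - by rewrite isometry_perp_iter.
    - by rewrite !isometry_iter; have := y_le i; lra.
  have -> : iter m' g (tnth y i) = iter m g (iter (m' - m) g (tnth y i)).
    by rewrite -iterD subnKC // ltnW.
  rewrite -iterB -memvN.
  move=> /vlineP[k kE]; apply/vlineP; exists k.
  have iter_inj q : injective (iter q g).
    by elim: q => //= q IH; apply: inj_comp IH; exact: can_inj isometry_K.
  by apply: (iter_inj m); rewrite iter_line -kE !iterB opprB.
have -> : iter (m' - m) g v - v =
    \sum_i coord y i v *: (iter (m' - m) g (tnth y i) - tnth y i).
  rewrite {1 2}(coord_span (y_span _ vu)).
  have iter_sum q : iter q g (\sum_i coord y i v *: y`_i) =
      \sum_i coord y i v *: iter q g (tnth y i).
    elim: q => [|q IH]; first by apply: eq_bigr => i _; rewrite (tnth_nth 0).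
    rewrite iterS IH linear_sum; apply: eq_bigr => i _; by rewrite linearZ.
  rewrite iter_sum -sumrB; apply: eq_bigr => i _.
  by rewrite scalerBr -tnth_nth.
by rewrite memv_suml // => i _; rewrite memvZ.
Qed.

(* On the definite space u^perp / u a unipotent isometry is trivial: if
   g x = x + y and g y = y modulo u, then b y y = 0. *)
Lemma unipotent_perp : unipotent g ->
  forall v, b v u = 0 -> g v - v \in <[u]>%VS.
Proof.
move=> [m gm] v vu.
pose h w := g w - w.
have hu w : b w u = 0 -> b (h w) u = 0.
  by move=> wu; rewrite formDl formNl isometry_perp wu subrr.
have step w : b w u = 0 -> h (h w) \in <[u]>%VS -> h w \in <[u]>%VS.
  move=> wu /vlineP[k hy]; have yu := hu _ wu.
  apply: (perp_isotropic dimV b_sign u0 uu yu).2.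
  have gw : g w = w + h w by rewrite addrC subrK.
  have gy : g (h w) = h w + k *: u by rewrite -hy addrC subrK.
  move: (h w) yu gw gy => y yu gw gy.
  have := g_iso w w; have := g_iso w y; rewrite gw gy !formE wu yu (formC b y w).
  by move=> H1 H2; lra.
have iter_hu q : b (iter q h v) u = 0 by elim: q => [|q] //; rewrite iterS; exact: hu.
have down q : iter q.+1 h v \in <[u]>%VS -> h v \in <[u]>%VS.
  by elim: q => // q IH hh; apply: IH; exact: (step _ (iter_hu q) hh).
by apply: (down m); rewrite iterS gm /h linear0 subr0 mem0v.
Qed.

End Isometry.
End Isotropic.

(** * Unipotent radicals and the arithmetic group *)

Section UnipotentRadical.
Variables (V : vectType rat) (b : {symmetric V}).
Hypothesis b_nondeg : nondegenerate b.
Variable l : {vspace V}.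

Lemma mxQ_comp (g k : 'End(V)) : mxQ (g \o k)%VF = mxQ k *m mxQ g.
Proof. by rewrite /mxQ (mxof_comp _ _ (vbasisP _)). Qed.

Lemma mxQ1 : mxQ (\1%VF : 'End(V)) = 1%:M.
Proof. by rewrite /mxQ mxof1 // (basis_free (vbasisP _)). Qed.

Lemma parabolic1 : parabolic b l \1%VF.
Proof. by split=> [v w||]; rewrite ?id_lfunE ?lim1g ?mxQ1 ?det1. Qed.

Lemma parabolic_comp g k :
  parabolic b l g -> parabolic b l k -> parabolic b l (g \o k)%VF.
Proof.
move=> [gb gd gl] [kb kd kl]; split=> [v w||]; first by rewrite !comp_lfunE gb kb.
  by rewrite mxQ_comp det_mulmx gd kd mulr1.
by rewrite limg_comp kl gl.
Qed.

Lemma parabolic_inv g : parabolic b l g -> parabolic b l (g^-1)%VF.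
Proof.
move=> [gb gd gl]; have gK := isometry_K b_nondeg gb.
have gVg : (g^-1 \o g)%VF = \1%VF by apply/lfunP => v; rewrite comp_lfunE gK id_lfunE.
split; first exact: isometry_inv.
  have : \det (mxQ (g^-1 \o g)%VF) = 1 by rewrite gVg mxQ1 det1.
  by rewrite mxQ_comp det_mulmx gd mul1r.
by rewrite -[in LHS]gl -limg_comp gVg lim1g.
Qed.

Lemma parabolic_inv_mem g v : parabolic b l g -> v \in l -> (g^-1)%VF v \in l.
Proof. by move=> /parabolic_inv[_ _ gl] vl; rewrite -gl memv_img. Qed.

Lemma parabolic_mem g v : parabolic b l g -> v \in l -> g v \in l.
Proof. by move=> [_ _ gl] vl; rewrite -gl memv_img. Qed.

Lemma parabolic_orthov g v :
  parabolic b l g -> v \in orthov b l -> g v \in orthov b l.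
Proof.
move=> Pg /mem_orthovP vl; apply/mem_orthovP => w wl.
have [gb _ _] := Pg; rewrite -(isometry_VK b_nondeg gb w) gb.
by apply: vl; exact: parabolic_inv_mem.
Qed.

Lemma unipotent_radicalI g : isotropic_line b l -> parabolic b l g ->
  (forall v, v \in l -> g v = v) -> (forall v, v \in orthov b l -> g v - v \in l) ->
  unipotent_radical (parabolic b l) g.
Proof.
move=> [_ l_iso] Pg gl glo.
have fixI (y : 'End(V)) : parabolic b l y -> (forall v, v \in l -> y v = v) ->
    forall v, v \in l -> (y^-1)%VF v = v.
  by move=> [yb _ _] yl v vl; rewrite -{1}(yl v vl) (isometry_K b_nondeg yb).
exists [set y | [/\ parabolic b l y, forall v, v \in l -> y v = v
                  & forall v, v \in orthov b l -> y v - v \in l]].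
split=> //=.
- split=> /=.
  + split=> [|v vl|v vl]; rewrite ?id_lfunE ?subrr ?mem0v //; exact: parabolic1.
  + move=> y z [Py yl yo] [Pz zl zo].
    split=> [|v vl|v vl]; first exact: parabolic_comp.
      by rewrite comp_lfunE zl // yl.
    rewrite comp_lfunE -(subrK (z v) (y (z v))) -addrA.
    by apply: memvD; [apply: yo; exact: parabolic_orthov | exact: zo].
  + move=> y [Py yl yo]; have [yb _ _] := Py.
    split; first exact: isometry_inj yb.
    split=> [|v vl|v vl]; [exact: parabolic_inv | exact: fixI |].
    have vo := parabolic_orthov (parabolic_inv Py) vl.
    rewrite -memvN opprB -{1}(isometry_VK b_nondeg yb v).
    exact: yo.
- by move=> y [].
- move=> x y Px [Py yl yo]; have [xb _ _] := Px.
  split=> [|v vl|v vl].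
  + by apply: parabolic_comp; [exact: parabolic_comp | exact: parabolic_inv].
  + by rewrite !comp_lfunE yl ?(isometry_VK b_nondeg xb) // parabolic_inv_mem.
  + rewrite !comp_lfunE -{2}(isometry_VK b_nondeg xb v) -linearB.
    apply: parabolic_mem => //; apply: yo.
    exact: parabolic_orthov (parabolic_inv Px) vl.
- move=> y [[yb _ _] yl yo]; exists 3%N => v /=.
  have yvo : y v - v \in orthov b l.
    apply/mem_orthovP => w wl.
    by rewrite formDl formNl -{1}(yl w wl) yb subrr.
  by rewrite (yl _ (yo _ yvo)) subrr.
Qed.

End UnipotentRadical.

Section ArithmeticGroup.
Variables (R : realType) (V : vectType rat) (b : {symmetric V}) (p : nat).
Variables (L : set V) (B : set 'rV[R]_(\dim {:V})) (Gam : set 'End(V)).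
Hypotheses (dimV : \dim {:V} = p.+1) (b_sign : has_signature b p 1).
Hypotheses (b_nondeg : nondegenerate b) (L_lattice : is_lattice L).
Hypotheses (L_dual : L `<=` dual_lattice b L).
Hypotheses (B_component : hyperboloid_component b B).
Hypotheses (Gam_stab : Gam `<=` lattice_stabilizer R b L).

Lemma Gam_iso g : Gam g -> forall v w, b (g v) (g w) = b v w.
Proof. by move=> /Gam_stab[/G0_R_SO gSO _]; exact: SO_R_form gSO. Qed.

Lemma Gam_det g : Gam g -> \det (mxQ g) = 1.
Proof. by move=> /Gam_stab[/G0_R_SO gSO _]; exact: SO_R_det gSO. Qed.

Lemma Gam_B g Z : Gam g -> B Z -> B (Z *m mxR R g).
Proof. by move=> /Gam_stab[gG _]; exact: (G0_R_component B_component gG). Qed.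

Lemma Gam_L g v : Gam g -> L v -> L (g v).
Proof.
move=> /Gam_stab[_ gL] Lv; have : [set g v | v in L] (g v) by exists v.
by rewrite gL.
Qed.

Lemma formR_Gam g v Z : Gam g ->
  formR b (vecR R (g v)) (Z *m mxR R g) = formR b (vecR R v) Z.
Proof. by move=> /Gam_stab[/G0_R_SO[gb _] _]; rewrite vecR_app gb. Qed.

Lemma B_nonempty : exists Z, B Z.
Proof.
have [Z0 Z0h ->] := B_component; exists Z0; exact: connected_component_refl.
Qed.

Hypothesis (Gam_group : is_subgroup Gam).

Lemma Gam_inv g : Gam g -> Gam (g^-1)%VF.
Proof. by have [_ _ H] := Gam_group => /H[]. Qed.

Lemma Gam_K g : Gam g -> cancel g (g^-1)%VF.
Proof. by move=> /Gam_iso gb; exact: isometry_K gb. Qed.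

Lemma Gam_VK g : Gam g -> cancel (g^-1)%VF g.
Proof. by move=> /Gam_iso gb; exact: isometry_VK gb. Qed.

Lemma Gam_parabolic g l : Gam g -> (g @: l)%VS = l -> parabolic b l g.
Proof. by move=> Gg gl; split=> //; [exact: Gam_iso | exact: Gam_det]. Qed.

Section Line.
Variables (l : {vspace V}) (u : V).
Hypotheses (l_iso : isotropic_line b l) (u_gen : primitive_generator b L B l u).

Lemma generator_span : l = <[u]>%VS /\ u != 0.
Proof.
have [l1 _] := l_iso; have [lL _] := u_gen.
have lLE v : v \in l -> L v -> exists k : int, v = u *~ k.
  move=> vl Lv; have : [set v | v \in l /\ L v] v by [].
  by rewrite lL => -[k _ <-]; exists k.
have ul : u \in l.
  have : [set u *~ k | k in [set: int]] u by exists 1; rewrite ?mulr1z.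
  by rewrite -lL => -[].
have [w wl w0] : exists2 w, w \in l & w != 0.
  by exists (vpick l); rewrite ?memv_pick // vpick0 -dimv_eq0 l1.
have u0 : u != 0.
  have [N N0 /(_ tt) NL] := lattice_multiple L_lattice (fun _ : unit => w).
  have [k kE] := lLE _ (memvZ N%:R wl) NL.
  apply/eqP => u0; move/eqP: kE; rewrite u0 mul0rz scaler_eq0 (negPf w0).
  by rewrite pnatr_eq0 (gtn_eqF N0).
split=> //; apply/esym/eqP; rewrite eqEdim dim_vline u0 l1 andbT.
by rewrite -memvE.
Qed.

Lemma generator_mem v : v \in l -> L v -> exists k : int, v = u *~ k.
Proof.
move=> vl Lv; have [lL _] := u_gen; have : [set v | v \in l /\ L v] v by [].
by rewrite lL => -[k _ <-]; exists k.
Qed.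

Lemma generator_lattice : L u.
Proof.
have [lL _] := u_gen.
have : [set u *~ k | k in [set: int]] u by exists 1; rewrite ?mulr1z.
by rewrite -lL => -[].
Qed.

Lemma generator_isotropic : b u u = 0.
Proof.
have [_ l0] := l_iso; apply: l0; have [-> _] := generator_span.
exact: memv_line.
Qed.

Lemma Gam_fix_generator g : Gam g -> (g @: l)%VS = l -> g u = u.
Proof.
move=> Gg gl; have [lu u0] := generator_span.
have ul : u \in l by rewrite lu memv_line.
have [k gu] : exists k : int, g u = u *~ k.
  apply: generator_mem; first by rewrite -gl memv_img.
  by apply: Gam_L => //; exact: generator_lattice.
have [k' gVu] : exists k : int, (g^-1)%VF u = u *~ k.
  apply: generator_mem; last by apply: Gam_L (Gam_inv Gg) _; exact: generator_lattice.
  exact: (parabolic_inv_mem b_nondeg (Gam_parabolic Gg gl)).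
have kk : k' * k = 1.
  have : u *~ (k * k') = u *~ 1.
    by rewrite mulr1z -[RHS](Gam_VK Gg) gVu raddfMz /= gu -mulrzA.
  rewrite -!scaler_int => /eqP; rewrite -subr_eq0 -scalerBl scaler_eq0 (negPf u0).
  by rewrite orbF subr_eq0 eqr_int => /eqP; rewrite mulrC.
have k0 : 0 < k.
  have [Z BZ] := B_nonempty; have [_ neg] := u_gen.
  have := neg _ (Gam_B Gg BZ); have := formR_Gam u Z Gg; have := neg _ BZ.
  have -> : vecR R (g u) = k%:~R *: vecR R u.
    rewrite gu -scaler_int /vecR linearZ /=; apply/rowP => j.
    by rewrite !mxE rmorphM /= ratr_int.
  rewrite !formRE mxformZl => n1 kE n2; rewrite -(ltr0z R).
  by rewrite ltNge; apply/negP => k0; move: n1; rewrite -kE; nra.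
have k'0 : 0 < k' by nia.
have k1 : k = 1 by nia.
by rewrite gu k1 mulr1z.
Qed.

Lemma Gam_unipotent g : neat Gam -> Gam g -> (g @: l)%VS = l ->
  unipotent_radical (parabolic b l) g /\
  forall v, v \in orthov b l -> g v - v \in l.
Proof.
move=> Gam_neat Gg gl; have [lu u0] := generator_span.
have gu := Gam_fix_generator Gg gl; have uu := generator_isotropic.
have g_iso := Gam_iso Gg.
have gL : [set g v | v in L] `<=` L by move=> _ [w Lw <-]; exact: Gam_L.
have [N N0 gN] := finite_order_perp dimV b_sign L_lattice u0 uu
                    b_nondeg L_dual g_iso gu gL.
have g_unip : unipotent g.
  apply: (neat_quasi_unipotent Gam_neat Gg N0) => v x y.
  have /gN/vlineP[k yE] : b x u = 0.
    by rewrite formDl formNl (isometry_perp g_iso gu) subrr.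
  by rewrite /y yE linearZ /= gu.
have g_perp v : v \in orthov b l -> g v - v \in l.
  rewrite lu mem_orthov1 => /eqP vu.
  exact: (unipotent_perp dimV b_sign u0 uu g_iso gu).
split=> //; apply: unipotent_radicalI => //; first exact: Gam_parabolic.
by move=> v; rewrite lu => /vlineP[k ->]; rewrite linearZ /= gu.
Qed.

End Line.
End ArithmeticGroup.

(** * Tuples and their radicals *)

Section Tuples.
Variables (V : vectType rat) (b : {symmetric V}) (n : nat).
Implicit Types (X : n.-tuple V) (y : 'cV[rat]_n) (g : 'End(V)).

Definition lin_comb X y : V := \sum_i y i 0 *: tnth X i.

Lemma lin_comb_int X (a : 'cV[int]_n) :
  lin_comb X (map_mx intr a) = \sum_i tnth X i *~ a i 0.
Proof. by apply: eq_bigr => i _; rewrite mxE scaler_int. Qed.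

Lemma lin_comb_span X y : lin_comb X y \in <<X>>%VS.
Proof.
by rewrite memv_suml // => i _; rewrite memvZ // memv_span // mem_tnth.
Qed.

Lemma span_lin_comb X v : v \in <<X>>%VS -> exists y, v = lin_comb X y.
Proof.
move=> vX; exists (\col_i coord X i v); rewrite {1}(coord_span vX).
by apply: eq_bigr => i _; rewrite mxE -tnth_nth.
Qed.

Lemma lin_comb_eq0 X y : \dim <<X>> = n -> lin_comb X y = 0 -> y = 0.
Proof.
move=> dX yX; have /freeP X_free : free X by rewrite /free dX size_tuple.
apply/colP => i; rewrite mxE; apply: (X_free (fun i => y i 0)).
by rewrite -[RHS]yX; apply: eq_bigr => j _; rewrite -tnth_nth.
Qed.

Lemma form_lin_comb X y i : b (tnth X i) (lin_comb X y) = (gram b X *m y) i 0.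
Proof.
rewrite form_sumr mxE; apply: eq_bigr => j _.
by rewrite formZr mxE mulrC.
Qed.

Lemma tnth_act g X i : tnth (act_tuple g X) i = g (tnth X i).
Proof. by rewrite !(tnth_nth 0) /= (nth_map 0) ?size_tuple. Qed.

Lemma act_comp g k X : act_tuple (g \o k)%VF X = act_tuple g (act_tuple k X).
Proof. by apply: eq_from_tnth => i; rewrite !tnth_act comp_lfunE. Qed.

Lemma act1 X : act_tuple \1%VF X = X.
Proof. by apply: eq_from_tnth => i; rewrite !tnth_act id_lfunE. Qed.

Lemma span_act g X : <<act_tuple g X>>%VS = (g @: <<X>>)%VS.
Proof. by rewrite limg_span. Qed.

Lemma lin_comb_act g X y : lin_comb (act_tuple g X) y = g (lin_comb X y).
Proof.
by rewrite linear_sum; apply: eq_bigr => i _; rewrite tnth_act linearZ.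
Qed.

Section Isometric.
Hypothesis b_nondeg : nondegenerate b.
Variable g : 'End(V).
Hypothesis g_iso : forall v w, b (g v) (g w) = b v w.

Lemma radical_img U : radical b (g @: U) = (g @: radical b U)%VS.
Proof.
apply/vspaceP => v; rewrite memv_cap; apply/andP/memv_imgP.
  case=> /memv_imgP[w wU ->] /mem_orthovP wo; exists w => //.
  rewrite memv_cap wU; apply/mem_orthovP => z zU.
  by rewrite -g_iso; apply: wo; rewrite memv_img.
case=> w; rewrite memv_cap => /andP[wU /mem_orthovP wo] ->.
split; first by rewrite memv_img.
by apply/mem_orthovP => _ /memv_imgP[z zU ->]; rewrite g_iso; exact: wo.
Qed.

Lemma gram_act X : gram b (act_tuple g X) = gram b X.
Proof. by apply/matrixP => i j; rewrite !mxE !tnth_act g_iso. Qed.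

Lemma Omega_s_act beta X : Omega_s b beta X -> Omega_s b beta (act_tuple g X).
Proof.
move=> [Xb Xd]; split; first by rewrite gram_act.
by rewrite span_act limg_dim_eq // (isometry_inj b_nondeg g_iso) capv0.
Qed.

End Isometric.

Lemma radical_perp X i v : v \in radical b <<X>> -> b (tnth X i) v = 0.
Proof.
rewrite memv_cap => /andP[_ /mem_orthovP vo].
by rewrite formC vo // memv_span // mem_tnth.
Qed.

Section Radical.
Variables (beta : 'M[rat]_n) (n_gt0 : (0 < n)%N).
Hypotheses (beta_sym : beta^T = beta) (beta_rank : \rank beta = n.-1).

Lemma corank1_kernel (a y : 'cV[rat]_n) : a != 0 -> beta *m a = 0 ->
  beta *m y = 0 -> exists c, y = c *: a.
Proof.
have kerE (z : 'cV[rat]_n) : beta *m z = 0 -> (z^T <= kermx beta)%MS.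
  by move=> bz; apply/sub_kermxP; rewrite -beta_sym -trmx_mul bz trmx0.
move=> a0 /kerE aK /kerE yK.
have ker_a : (kermx beta <= a^T)%MS.
  rewrite -(mxrank_leqif_sup aK) mxrank_ker beta_rank rank_rV -subn1 subKn //.
  by rewrite -trmx0 (inj_eq trmx_inj) a0.
have /sub_rVP[c yE] := submx_trans yK ker_a.
by exists c; apply: trmx_inj; rewrite linearZ.
Qed.

Lemma Omega_s_form X y i : Omega_s b beta X ->
  b (tnth X i) (lin_comb X y) = 2 * (beta *m y) i 0.
Proof.
move=> [<- _]; rewrite form_lin_comb -scalemxAl [in RHS]mxE mulrA mulfV //.
by rewrite mul1r.
Qed.

Lemma Omega_s_radical X a : Omega_s b beta X -> a != 0 -> beta *m a = 0 ->
  radical b <<X>> = <[lin_comb X a]>%VS /\ lin_comb X a != 0.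
Proof.
move=> OX a0 ba; have [_ dX] := OX; split; last first.
  by apply: contraNneq a0 => /(lin_comb_eq0 dX) ->.
have orth y : beta *m y = 0 -> lin_comb X y \in orthov b <<X>>.
  move=> by0; apply/mem_orthovP => _ /span_lin_comb[z ->].
  rewrite formC form_suml big1 // => i _.
  by rewrite formZl Omega_s_form // by0 mxE !mulr0.
apply/vspaceP => v; rewrite memv_cap; apply/andP/vlineP.
  case=> /span_lin_comb[y ->] /mem_orthovP yo.
  have : beta *m y = 0.
    apply/colP => i; rewrite [RHS]mxE; apply: (@mulfI _ 2) => //.
    rewrite mulr0 -(Omega_s_form y i OX) formC.
    by apply: yo; rewrite memv_span // mem_tnth.
  move=> /(corank1_kernel a0 ba)[c ->]; exists c.
  by rewrite /lin_comb scaler_sumr; apply: eq_bigr => i _; rewrite mxE scalerA.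
case=> c ->; split; first by rewrite memvZ // lin_comb_span.
by rewrite memvZ // orth.
Qed.

Lemma primitive_neq0 (a : 'cV[int]_n) :
  primitive_vector a -> map_mx intr a != 0 :> 'cV[rat]_n.
Proof.
move=> a1; apply/eqP => a0.
suff : \big[gcdn/0%N]_(i < n) `|a i ord0|%N = 0%N by rewrite a1.
rewrite big1 // => i _; have /colP/(_ i) := a0; rewrite !mxE => /eqP.
by rewrite intr_eq0 => /eqP ->.
Qed.

Lemma primitive_unique (a a' : 'cV[int]_n) :
  primitive_vector a -> beta *m map_mx intr a = 0 ->
  primitive_vector a' -> beta *m map_mx intr a' = 0 ->
  a' = a \/ a' = - a.
Proof.
move=> a1 ba a1' ba'.
have [c cE] := corank1_kernel (primitive_neq0 a1) ba ba'.
have cross i : denq c * a' i 0 = numq c * a i 0.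
  have /colP/(_ i) := cE; rewrite !mxE -{1}(divq_num_den c) => E.
  apply: (@intr_inj rat); rewrite !rmorphM /= E mulrA; congr (_ * _).
  by rewrite mulrC divfK // intr_eq0 denq_eq0.
have gcdM k (v : 'cV[int]_n) : \big[gcdn/0%N]_(i < n) `|(k * v i 0)%R|%N =
    (`|k| * \big[gcdn/0%N]_(i < n) `|v i ord0|)%N.
  rewrite (big_morph _ (muln_gcdr `|k|%N) (muln0 _)).
  by apply: eq_bigr => i _; rewrite abszM.
have dn : `|denq c|%N = `|numq c|%N.
  have := gcdM (denq c) a'; have := gcdM (numq c) a.
  rewrite a1 a1' !muln1 => <- <-.
  by apply: eq_bigr => i _; rewrite cross.
have d0 := denq_neq0 c.
have [nE|nE] : numq c = denq c \/ numq c = - denq c by lia.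
- by left; apply/colP => i; apply: (mulfI d0); rewrite cross nE.
- right; apply/colP => i; apply: (mulfI d0); rewrite cross nE !mxE.
  by rewrite mulNr mulrN.
Qed.

End Radical.
End Tuples.

(** * Eichler transformations preserving a lattice *)

Section EichlerLattice.
Variables (V : vectType rat) (b : {symmetric V}) (L : set V).
Hypotheses (L_lattice : is_lattice L).
Hypothesis L_dual : L `<=` dual_lattice b L.
Variables (u w : V).
Hypotheses (uu : b u u = 0) (uw : b u w = 0).

Lemma eichlerK v : eichler b u w (eichler b u (- w) v) = v.
Proof.
have eB := vbasisP {:V}; pose r := rVof (vbasis {:V}).
have rE w' v' : r (eichler b u w' v') =
    r v' *m eichler_mx (gram b (vbasis {:V})) (r u) (r w').
  by rewrite /r /eichler (rVof_app _ eB) hommxK.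
apply: (can_inj (rVofK eB)); rewrite -/r !rE -mulmxA.
have -> : r (- w) = (- 1) *: r w by rewrite /r linearN scaleN1r.
rewrite -{2}[r w]scale1r eichler_mxD ?mxform_rVof ?gram_sym // addNr scale0r.
by rewrite mul_eichler_mx /mxform trmx0 !mulmx0 mxE !mul0r !scale0r scaler0 !subr0 addr0.
Qed.

Lemma eichler_lattice v : L u -> L (2^-1 *: w) -> L v -> L (eichler b u w v).
Proof.
set w' := 2^-1 *: w => Lu Lw' Lv.
have wE : w = 2 *: w' by rewrite scalerA mulfV // scale1r.
have Lw : L w by rewrite wE; apply: latticeZ_int.
have vu_int : b v u \is a Num.int by exact: L_dual.
rewrite eichlerE; apply: latticeB => //.
  apply: latticeB => //; first apply: latticeD => //.
  - by apply: latticeZ_int => //; exact: L_dual.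
  - exact: latticeZ_int.
apply: latticeZ_int => //; rewrite rpredM //.
have -> : b w w / 2 = 2 * b w' w' by rewrite wE !formE; field.
by rewrite rpredM //; exact: L_dual.
Qed.

End EichlerLattice.

Lemma eichler_stabilizer (R : realType) (V : vectType rat) (b : {symmetric V})
    (L : set V) u w : nondegenerate b -> is_lattice L ->
  L `<=` dual_lattice b L -> b u u = 0 -> b u w = 0 -> L u ->
  L (2^-1 *: w) -> lattice_stabilizer R b L (eichler b u w).
Proof.
move=> b_nondeg L_lattice L_dual uu uw Lu Lw; split; first exact: eichler_G0.
apply/seteqP; split=> [_ [v Lv <-]|v Lv]; first exact: eichler_lattice.
exists (eichler b u (- w) v); last exact: eichlerK.
by apply: eichler_lattice => //; rewrite scalerN; apply: latticeN.
Qed.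

Section SymmetricSolve.
Variables (n : nat) (beta : 'M[rat]_n) (a : 'cV[rat]_n).
Hypotheses (n_gt0 : (0 < n)%N) (beta_sym : beta^T = beta).
Hypotheses (beta_rank : \rank beta = n.-1) (a0 : a != 0) (ba : beta *m a = 0).

Lemma corank1_image (k : 'cV[rat]_n) :
  k^T *m a = 0 -> 2 *: (beta *m (2^-1 *: (k^T *m pinvmx beta)^T)) = k.
Proof.
move=> ka; have sub : (beta <= kermx a)%MS by apply/sub_kermxP.
have ker_sub : (kermx a <= beta)%MS.
  rewrite -(mxrank_leqif_sup sub) mxrank_ker beta_rank -mxrank_tr rank_rV.
  by rewrite -trmx0 (inj_eq trmx_inj) a0 subn1.
have kb : (k^T <= beta)%MS by apply: submx_trans ker_sub; apply/sub_kermxP.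
rewrite -scalemxAr scalerA mulfV // scale1r -{1}beta_sym -trmx_mul mulmxKpV //.
by rewrite trmxK.
Qed.

Lemma corank1_lattice_image (N : nat) : (0 < N)%N -> exists2 M : nat, (1 < M)%N &
  forall k : 'cV[int]_n, (map_mx intr k)^T *m a = 0 ->
  exists y : 'cV[int]_n,
    2 *: (beta *m (N%:R *: map_mx intr y)) = M%:R *: map_mx intr k.
Proof.
move=> N_gt0.
have [D D_gt0 DP] := common_denominator (
    fun ij : 'I_n * 'I_n => pinvmx beta ij.1 ij.2).
exists (2 * N * D)%N => [|k ka]; first by lia.
pose y := \col_i \sum_j k j 0 * Num.floor (D%:R * pinvmx beta j i).
exists y.
have yE : map_mx intr y = D%:R *: ((map_mx intr k)^T *m pinvmx beta)^T :> 'cV[rat]_n.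
  apply/colP => i; rewrite !mxE rmorph_sum mulr_sumr; apply: eq_bigr => j _.
  by rewrite rmorphM /= floorK ?(DP (j, i)) // !mxE; ring.
rewrite -[in RHS](corank1_image ka) yE -!scalemxAr !scalerA; congr (_ *: _).
by rewrite !natrM; field.
Qed.

End SymmetricSolve.

(** * Reduced tuples *)

Section ReducedTuples.
Variables (R : realType) (p n : nat) (V : vectType rat) (b : {symmetric V}).
Variables (L : set V) (h : n.-tuple V) (B : set 'rV[R]_(\dim {:V})).
Variables (Gam : set 'End(V)) (beta : 'M[rat]_n).
Hypotheses (dimV : \dim {:V} = p.+1) (b_nondeg : nondegenerate b).
Hypotheses (b_sign : has_signature b p 1) (L_lattice : is_lattice L).
Hypotheses (L_dual : L `<=` dual_lattice b L) (n_gt0 : (0 < n)%N).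
Hypothesis h_dual : forall i, dual_lattice b L (tnth h i).
Hypotheses (B_component : hyperboloid_component b B).
Hypotheses (Gam_group : is_subgroup Gam).
Hypotheses (Gam_stab : Gam `<=` lattice_stabilizer R b L).
Hypothesis Gam_trivial : forall g v, Gam g -> dual_lattice b L v -> L (g v - v).
Hypotheses (beta_sym : beta^T = beta) (beta_rank : \rank beta = n.-1).

Let Red := Omega_red b L B beta `&` lattice_coset L h.

Lemma Red_isotropic X : Red X -> isotropic_line b (radical b <<X>>).
Proof.
move=> [[OX [a [u [nu [a1 ba _ _ _]]]]] _]; split.
  have [-> nz] := Omega_s_radical n_gt0 beta_sym beta_rank OX (primitive_neq0 a1) ba.
  by rewrite dim_vline nz.
by move=> v; rewrite memv_cap => /andP[vX /mem_orthovP]; apply.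
Qed.

Lemma Red_generator X : Red X ->
  exists u, primitive_generator b L B (radical b <<X>>) u.
Proof. by move=> [[_ [a [u [nu [_ _ ? _ _]]]]] _]; exists u. Qed.

Lemma primitive_generator_act g l u : Gam g -> primitive_generator b L B l u ->
  primitive_generator b L B (g @: l) (g u).
Proof.
move=> Gg [lL neg]; split=> [|Z BZ]; last first.
  have gV := Gam_inv Gam_group Gg.
  have -> : Z = Z *m mxR R (g^-1)%VF *m mxR R g.
    rewrite -mulmxA -mxR_comp.
    have -> : (g \o g^-1)%VF = \1%VF.
      by apply/lfunP => v; rewrite comp_lfunE (Gam_VK b_nondeg Gam_stab) // id_lfunE.
    by rewrite mxR1 mulmx1.
  rewrite (formR_Gam Gam_stab) //; apply: neg.
  exact: (Gam_B B_component Gam_stab).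
apply/seteqP; split=> [v [/memv_imgP[w wl ->] Lgw]|_ [k _ <-]].
  have Lw : L w.
    rewrite -(Gam_K b_nondeg Gam_stab Gg w).
    exact: (Gam_L Gam_stab (Gam_inv Gam_group Gg)).
  have : [set v | v \in l /\ L v] w by [].
  by rewrite lL => -[k _ <-]; exists k; rewrite ?raddfMz.
have : [set u *~ k | k in [set: int]] (u *~ k) by exists k.
rewrite -lL -raddfMz => -[ul Lu].
by split; [rewrite memv_img | exact: (Gam_L Gam_stab Gg)].
Qed.

Lemma Red_act g X : Gam g -> Red X -> Red (act_tuple g X).
Proof.
move=> Gg [[OX [a [u [nu [a1 ba u_gen aX nu01]]]]] hX].
have g_iso := Gam_iso Gam_stab Gg; split; last first.
  move=> i; rewrite tnth_act.
  have -> : g (tnth X i) - tnth h i =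
      g (tnth X i - tnth h i) + (g (tnth h i) - tnth h i).
    by rewrite linearB /= addrA subrK.
  by apply: latticeD => //; [exact: (Gam_L Gam_stab Gg (hX i)) | exact: Gam_trivial].
split; first exact: Omega_s_act.
exists a, (g u), nu; split=> //.
  by rewrite span_act radical_img //; exact: primitive_generator_act.
by rewrite -lin_comb_int lin_comb_act lin_comb_int aX linearZ.
Qed.

Lemma Red_norm X i : Red X -> b (tnth X i) (tnth X i) = 2 * beta i i.
Proof. by move=> [[[<- _] _] _]; rewrite !mxE mulrA mulfV // mul1r. Qed.

Lemma Red_dual X i v : Red X -> L v -> b (tnth X i) v \is a Num.int.
Proof.
move=> [_ hX] Lv; rewrite -(subrK (tnth h i) (tnth X i)) formDl rpredD //.
  exact: (L_dual (hX i) Lv).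
exact: h_dual.
Qed.

Section FixedLine.
Variables (X1 : n.-tuple V) (u : V) (a : 'cV[int]_n).
Hypotheses (RX1 : Red X1).
Let l := radical b <<X1>>.
Hypotheses (u_gen : primitive_generator b L B l u).
Hypotheses (a_prim : primitive_vector a) (ba : beta *m map_mx intr a = 0).

Let l_iso : isotropic_line b l := Red_isotropic RX1.
Let lu : l = <[u]>%VS := (generator_span L_lattice l_iso u_gen).1.
Let u0 : u != 0 := (generator_span L_lattice l_iso u_gen).2.
Let uu : b u u = 0 := generator_isotropic L_lattice l_iso u_gen.
Let Lu : L u := generator_lattice u_gen.

Lemma Red_relation X : Red X -> radical b <<X>> = l ->
  exists2 mu : rat, `|mu| < 1 & lin_comb X (map_mx intr a) = mu *: u.
Proof.
move=> RX Xl; have [[OX [a' [u' [nu [a1' ba' u_gen' aX nu01]]]]] _] := RX.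
rewrite Xl in u_gen'.
have [m u'E] : exists m : int, u' = u *~ m.
  apply: (generator_mem u_gen); last exact: generator_lattice u_gen'.
  by rewrite (generator_span L_lattice l_iso u_gen').1 memv_line.
have [m' uE] : exists m' : int, u = u' *~ m'.
  apply: (generator_mem u_gen') Lu.
  by rewrite lu memv_line.
have mm' : m * m' = 1.
  have : u *~ (m * m') = u *~ 1 by rewrite mulrzA -u'E -uE mulr1z.
  rewrite -!scaler_int => /eqP; rewrite -subr_eq0 -scalerBl scaler_eq0 (negPf u0).
  by rewrite orbF subr_eq0 eqr_int => /eqP.
have m1 : m = 1 \/ m = - 1.
  have /eqP : (`|m| * `|m'|)%N = 1%N by rewrite -abszM mm'.
  by rewrite muln_eq1 => /andP[/eqP m1 _]; lia.
have nu1 : `|nu| < 1 by rewrite ger0_norm; case/andP: nu01.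
have relE : lin_comb X (map_mx intr a') = (nu * m%:~R) *: u.
  by rewrite lin_comb_int aX u'E -scaler_int scalerA.
have m_norm : `|nu * m%:~R| < 1.
  by rewrite normrM; have -> : `|m%:~R| = 1 :> rat; [case: m1 => -> | rewrite mulr1].
have [aE|aE] := primitive_unique n_gt0 beta_sym beta_rank a1' ba' a_prim ba.
  by exists (nu * m%:~R); rewrite // aE.
exists (- (nu * m%:~R)); first by rewrite normrN.
rewrite scaleNr -relE aE /lin_comb -sumrN; apply: eq_bigr => i _.
by rewrite !mxE rmorphN scaleNr.
Qed.

Lemma Red_congruent : exists P : nat, forall X X0, Red X -> Red X0 ->
  radical b <<X>> = l -> radical b <<X0>> = l ->
  (forall i y, L y ->
     exists m : int, b (tnth X0 i - tnth X i) y = m%:~R * P.+1%:R) ->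
  exists2 g, lattice_stabilizer R b L g & act_tuple g X = X0.
Proof.
have [P1 sep] := perp_lattice_separated dimV b_sign L_lattice u0 uu
  (\sum_i `|8 * beta i i|).
have [v uv] : exists v, b u v != 0.
  apply: contrapT => H; case/negP: u0; apply/eqP/(nondegenerate_eq0 b_nondeg) => v.
  by apply/eqP; apply: contrapT => /negP uv; apply: H; exists v.
have [Nv Nv_gt0 /(_ tt) LNv] := lattice_multiple L_lattice (fun _ : unit => v).
pose v' := Nv%:R *: v.
have [q uq] : exists q : int, b u v' = q%:~R.
  by apply/intrP; exact: L_dual Lu _ LNv.
have q0 : q != 0.
  by rewrite -(intr_eq0 rat) -uq formZr mulf_neq0 // pnatr_eq0 -lt0n.
have [Nh Nh_gt0 LNh] := lattice_multiple L_lattice (tnth h).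
have N2 : (0 < 2 * Nh)%N by rewrite muln_gt0.
have [M M_gt1 M_sol] := corank1_lattice_image n_gt0 beta_sym beta_rank
  (primitive_neq0 a_prim) ba N2.
pose P := (P1.+1 * (M * `|q|))%N.
have P_gt0 : (0 < P)%N by rewrite !muln_gt0 absz_gt0 q0 (ltnW M_gt1).
exists P.-1; rewrite prednK // => X X0 RX RX0 Xl X0l cong.
have perpX i : b (tnth X i) u = 0.
  by apply: radical_perp; rewrite Xl lu memv_line.
have perpX0 i : b (tnth X0 i) u = 0.
  by apply: radical_perp; rewrite X0l lu memv_line.
have diff i : exists k : int, tnth X0 i - tnth X i = u *~ k *+ M.
  have zl : tnth X0 i - tnth X i \in l.
    rewrite lu; apply: sep => [||y Ly].
    - by rewrite formDl formNl perpX perpX0 subrr.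
    - apply: le_trans (perp_norm_sub dimV b_sign u0 uu (perpX0 i) (perpX i)) _.
      rewrite !Red_norm // (bigD1 i) //=.
      have := ler_norm (8 * beta i i).
      have : 0 <= \sum_(j < n | j != i) `|8 * beta j j| by rewrite sumr_ge0.
      by lra.
    - have [m ->] := cong i y Ly; exists (m * (M * `|q|)%N).
      by rewrite /P natrM intrM -pmulrn; ring.
  have [k kE] : exists k : int, tnth X0 i - tnth X i = u *~ k.
    apply: (generator_mem u_gen zl).
    have -> : tnth X0 i - tnth X i = tnth X0 i - tnth h i - (tnth X i - tnth h i).
      by rewrite opprB addrA subrK.
    by have [_ hX] := RX; have [_ hX0] := RX0; exact: (latticeB L_lattice (hX0 i) (hX i)).
  have [m] := cong i v' LNv; rewrite kE -scaler_int formZl uq => E.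
  have {}E : k * q = m * P by apply: (@intr_inj rat); rewrite !rmorphM.
  exists (m * P1.+1 * sgz q); rewrite scaler_int pmulrn -mulrzA; congr (u *~ _).
  apply: (mulIf q0); rewrite E /P !PoszM abszE.
  by rewrite (normrEsg q); ring.
have /choice[k kE] := diff.
pose kc := \col_i k i.
have ka : (map_mx intr kc)^T *m map_mx intr a = 0 :> 'M[rat]_1.
  have [mu mu1 muX] := Red_relation RX Xl.
  have [mu0 mu01 muX0] := Red_relation RX0 X0l.
  pose s := \sum_i k i * a i 0.
  have sE : (M%:R * s%:~R) *: u = (mu0 - mu) *: u.
    rewrite scalerBl -muX -muX0 -sumrB rmorph_sum mulr_sumr scaler_suml.
    apply: eq_bigr => i _; rewrite -scalerBr kE pmulrn -mulrzA -scaler_int.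
    by rewrite scalerA !mxE !rmorphM /=; congr (_ *: _); ring.
  have {}sE : M%:R * s%:~R = mu0 - mu.
    have /eqP := sE; rewrite -subr_eq0 -scalerBl scaler_eq0 (negPf u0) orbF.
    by rewrite subr_eq0 => /eqP.
  have s0 : s = 0.
    have : `|(M%:Z * s)%:~R : rat| < 2%:~R.
      rewrite rmorphM /= sE; apply: le_lt_trans (ler_normB _ _) _; lra.
    by rewrite -intr_norm ltr_int; nia.
  apply/matrixP => i j; rewrite !ord1 !mxE.
  transitivity (s%:~R : rat); last by rewrite s0.
  rewrite rmorph_sum.
  by apply: eq_bigr => i' _; rewrite !mxE rmorphM.
have [y yE] := M_sol _ ka.
pose w := lin_comb X ((2 * Nh)%:R *: map_mx intr y).
have Xw i : b (tnth X i) w = (M%:Z * k i)%:~R.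
  have [[OX _] _] := RX; rewrite /w (Omega_s_form _ _ OX) rmorphM /=.
  by have /colP/(_ i) := yE; rewrite mxE => ->; rewrite !mxE.
have uw : b u w = 0.
  by rewrite form_sumr big1 // => i _; rewrite formZr formC perpX mulr0.
have Lw : L (2^-1 *: w).
  have -> : 2^-1 *: w = \sum_i (Nh%:R *: tnth X i) *~ y i 0.
    rewrite /w /lin_comb scaler_sumr; apply: eq_bigr => i _.
    by rewrite -scaler_int !scalerA !mxE natrM; congr (_ *: _); field.
  apply: lattice_sum => // i _; apply: latticeMz => //.
  rewrite -(subrK (tnth h i) (tnth X i)) scalerDr; apply: latticeD => //.
  by have [_ hX] := RX; exact: (latticeZ_int L_lattice _ (hX i)).
exists (eichler b u w); first exact: eichler_stabilizer.
apply: eq_from_tnth => i; rewrite tnth_act eichlerE perpX mulr0 !scale0r !subr0.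
by rewrite Xw scaler_int mulrC mulrzA -pmulrn -kE addrC subrK.
Qed.

End FixedLine.

Variables (r : nat) (ell : 'I_r.+1 -> {vspace V}).
Variable C : 'I_r.+1 -> {vspace V} -> set (n.-tuple V).
Hypothesis Gam_neat : neat Gam.
Hypothesis Gam_index : finite_index Gam (lattice_stabilizer R b L).
Hypothesis ell_isotropic : forall j, isotropic_line b (ell j).
Hypothesis ell_repr : forall l, isotropic_line b l ->
  exists! j, exists2 g : 'End(V), Gam g & (g @: l)%VS = ell j.
Hypothesis C_repr : forall j U, spans_at b L h beta (ell j) U ->
  orbit_representatives
    (Gam `&` unipotent_radical (parabolic b (ell j)))
    (Omega_span b beta U `&` lattice_coset L h) (C j U).

Lemma orbit_eq g (X Y : n.-tuple V) :
  Gam g -> act_tuple g X = Y -> orbit_of Gam X = orbit_of Gam Y.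
Proof.
move=> Gg <-; have [_ Gcomp _] := Gam_group.
apply/seteqP; split=> _ [k Gk <-].
  exists (k \o g^-1)%VF; first by apply: Gcomp => //; exact: Gam_inv.
  rewrite act_comp -(act_comp (g^-1)%VF); congr act_tuple.
  rewrite -[RHS]act1; congr act_tuple.
  by apply/lfunP => v; rewrite comp_lfunE (Gam_K b_nondeg Gam_stab) // id_lfunE.
by exists (k \o g)%VF; [exact: Gcomp | rewrite act_comp].
Qed.

Lemma finite_orbits_at j : exists T : seq (n.-tuple V), forall X, Red X ->
  radical b <<X>> = ell j -> exists2 Y, Y \in T & orbit_of Gam X = orbit_of Gam Y.
Proof.
have [[X1 [RX1 X1l]]|none] := pselect (exists X1, Red X1 /\ radical b <<X1>> = ell j);
  last by exists [::] => X RX Xl; case: none; exists X.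
have [[_ [a [u [_ [a1 ba u_gen _ _]]]]] _] := RX1.
have [P cong] := Red_congruent RX1 u_gen a1 ba.
have [e [eB eL]] := L_lattice.
have Le i : L (tnth e i).
  rewrite eL; exists (fun j => (j == i)%:Z); rewrite (bigD1 i) //= eqxx mulr1z.
  by rewrite big1 ?addr0 // => i' /negPf ->.
pose D X := [ffun ik : 'I_n * 'I_(\dim {:V}) =>
  residue P (b (tnth X ik.1) (tnth e ik.2))].
have [s sP] := Gam_index.
pose good d X := [/\ Red X, radical b <<X>> = ell j & D X = d].
pose rep d := xget X1 (good d).
exists [seq act_tuple (t^-1)%VF (rep d) | t <- s,
          d <- enum {: {ffun 'I_n * 'I_(\dim {:V}) -> 'I_P.+1}}] => X RX Xl.
have [RY Yl DY] : good (D X) (rep (D X)).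
  by apply: (@xgetPex _ X1 (good (D X))); exists X.
have [g Gg gX] : exists2 g, lattice_stabilizer R b L g & act_tuple g X = rep (D X).
  apply: cong => //; rewrite ?X1l //.
  move=> i y; rewrite eL => -[c ->].
  have ck k : exists m : int,
      b (tnth (rep (D X)) i - tnth X i) (tnth e k) = m%:~R * P.+1%:R.
    rewrite formDl formNl; apply: residue_eq; [exact: Red_dual | exact: Red_dual |].
    by have /ffunP/(_ (i, k)) := DY; rewrite !ffunE.
  have /choice[m mP] := ck; exists (\sum_k m k * c k).
  rewrite form_sumr rmorph_sum mulr_suml; apply: eq_bigr => k _.
  by rewrite -scaler_int formZr mP rmorphM /=; ring.
have [t [ts _ Gtg]] := sP _ Gg.
exists (act_tuple (t^-1)%VF (rep (D X))).
  by apply/allpairsP; exists (t, D X); rewrite mem_enum.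
by apply: (orbit_eq Gtg); rewrite act_comp gX.
Qed.

Lemma Red_move X : Red X -> exists j, exists2 g, Gam g &
  radical b <<act_tuple g X>> = ell j.
Proof.
move=> RX; have [j [[g Gg gl] _]] := ell_repr (Red_isotropic RX).
by exists j, g => //; rewrite span_act radical_img //; exact: (Gam_iso Gam_stab).
Qed.

Lemma finite_orbits : finite_set [set orbit_of Gam X | X in Red].
Proof.
have /choice[T TP] := finite_orbits_at.
pose T' := flatten [seq T j | j <- enum 'I_r.+1].
apply: (@sub_finite_set _ _ [set orbit_of Gam X | X in [set` T']]); last first.
  exact/finite_image/finite_seq.
move=> _ [X RX <-]; have [j [g Gg gXl]] := Red_move RX.
have [Y YT XY] := TP j _ (Red_act Gg RX) gXl.
exists Y; last by rewrite -XY; apply/esym/(orbit_eq Gg).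
by apply/flatten_mapP; exists j => //; rewrite mem_enum.
Qed.

Let reps := \bigcup_j \bigcup_(U in spans_at b L h beta (ell j))
  (C j U `&` Omega_red b L B beta).

Lemma reps_Red j U Y : spans_at b L h beta (ell j) U -> C j U Y ->
  Omega_red b L B beta Y ->
  [/\ Red Y, radical b <<Y>> = ell j & <<Y>>%VS = U].
Proof.
move=> jU CY OY; have [/(_ _ CY)[[_ YU] hY] _] := C_repr jU.
have [X [_ _ Xl XU]] := jU.
by split=> //; rewrite YU -XU.
Qed.

Lemma reps_unique g Y Y' : Gam g -> reps Y -> reps Y' -> act_tuple g Y = Y' ->
  Y = Y'.
Proof.
move=> Gg [j _ [U jU [CY OY]]] [j' _ [U' jU' [CY' OY']]] gY.
have [RY Yl YU] := reps_Red jU CY OY; have [RY' Yl' YU'] := reps_Red jU' CY' OY'.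
have g_iso := Gam_iso Gam_stab Gg.
have [Gam1 _ _] := Gam_group.
have gl' : (g @: ell j)%VS = ell j' by rewrite -Yl -radical_img // -span_act gY.
have jj' : j = j'.
  have [j0 [_ j0_uniq]] := ell_repr (ell_isotropic j).
  rewrite -(j0_uniq j) ?(j0_uniq j') //; first by exists g.
  by exists \1%VF; rewrite ?lim1g.
move: jU' CY' Yl'; rewrite -jj' => jU' CY' Yl'; rewrite -jj' in gl'.
have [u u_gen] := Red_generator RY; rewrite Yl in u_gen.
have unip k (Gk : Gam k) (kl : (k @: ell j)%VS = ell j) := Gam_unipotent dimV
  b_sign b_nondeg L_lattice L_dual B_component Gam_stab Gam_group
  (ell_isotropic j) u_gen Gam_neat Gk kl.
have [g_unip g_perp] := unip _ Gg gl'.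
have lU : (ell j <= U)%VS by rewrite -Yl -YU capvSl.
have UU' : U' = U.
  have gU : (g @: U <= U)%VS.
    apply/subvP => _ /memv_imgP[v vU ->]; rewrite -(subrK v (g v)) memvD //.
    apply: (subvP lU); apply: g_perp; apply/mem_orthovP => w.
    rewrite -Yl memv_cap YU => /andP[_ /mem_orthovP wo].
    by rewrite formC; exact: wo.
  rewrite -YU' -gY span_act YU; apply/eqP; rewrite eqEdim gU /=.
  by rewrite limg_dim_eq // (isometry_inj b_nondeg g_iso) capv0.
rewrite UU' in CY'.
have [_ /(_ Y)] := C_repr jU.
case=> [|Z [_ Z_uniq]]; first by have [[OsY _] hY] := RY.
rewrite -(Z_uniq Y) ?(Z_uniq Y') //; split=> //; first by exists g.
by exists \1%VF; [split=> //; apply: (unip _ Gam1 _).1; rewrite lim1g | exact: act1].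
Qed.

Lemma reps_orbit_representatives : orbit_representatives Gam Red reps.
Proof.
have [Gam1 Gcomp _] := Gam_group.
split=> [Y [j _ [U jU [CY OY]]]|X RX]; first by have [] := reps_Red jU CY OY.
have [j [g Gg gXl]] := Red_move RX; have RgX := Red_act Gg RX.
have [[OgX _] hgX] := RgX.
have jU : spans_at b L h beta (ell j) <<act_tuple g X>>%VS.
  by exists (act_tuple g X).
have [_ /(_ (act_tuple g X))] := C_repr jU.
case=> [//|Y [[CY [k [Gk _] kY]] _]].
have RY : Red Y by rewrite -kY; exact: Red_act.
have CrY : reps Y.
  by exists j => //; exists <<act_tuple g X>>%VS => //; split=> //; case: RY.
exists Y; split.
  by split=> //; exists (k \o g)%VF; [exact: Gcomp | rewrite act_comp].
move=> Y' [CrY' [k' Gk' k'X]].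
apply: (@reps_unique ((k' \o (k \o g)^-1)%VF)) => //.
  exact: (Gcomp _ _ Gk' (Gam_inv Gam_group (Gcomp _ _ Gk Gg))).
rewrite act_comp -k'X; congr act_tuple; rewrite -kY -(act_comp k g) -act_comp -[RHS]act1.
congr act_tuple; apply/lfunP => v.
by rewrite comp_lfunE (Gam_K b_nondeg Gam_stab (Gcomp _ _ Gk Gg)) id_lfunE.
Qed.

End ReducedTuples.

Theorem lemma3p4 (R : realType) (p n : nat) (V : vectType rat)
    (b : {symmetric V}) (L : set V) (h : n.-tuple V)
    (B : set 'rV[R]_(\dim {:V})) (Gam : set 'End(V))
    (r : nat) (ell : 'I_r.+1 -> {vspace V}) (beta : 'M[rat]_n)
    (C : 'I_r.+1 -> {vspace V} -> set (n.-tuple V))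
    (dimV : \dim {:V} = p.+1)
    (b_nondeg : nondegenerate b)
    (b_sign : has_signature b p 1)
    (L_lattice : is_lattice L)
    (L_dual : L `<=` dual_lattice b L)
    (n_bounds : (1 <= n <= p)%N)
    (h_dual : forall i, dual_lattice b L (tnth h i))
    (B_component : hyperboloid_component b B)
    (Gam_group : is_subgroup Gam)
    (Gam_stab : Gam `<=` lattice_stabilizer R b L)
    (Gam_index : finite_index Gam (lattice_stabilizer R b L))
    (Gam_neat : neat Gam)
    (Gam_trivial : forall g v, Gam g -> dual_lattice b L v -> L (g v - v))
    (V_isotropic : exists2 v : V, v != 0 & b v v = 0)
    (ell_isotropic : forall j, isotropic_line b (ell j))
    (ell_repr : forall l, isotropic_line b l ->
      exists! j, exists2 g : 'End(V), Gam g & (g @: l)%VS = ell j)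
    (beta_psd : pos_semidefinite beta)
    (beta_rank : \rank beta = n.-1)
    (* the subgroup of Gamma_j fixing U pointwise acts trivially on the set
       below, so the orbits of the quotient by it are the orbits of Gamma_j *)
    (C_repr : forall j U, spans_at b L h beta (ell j) U ->
      orbit_representatives
        (Gam `&` unipotent_radical (parabolic b (ell j)))
        (Omega_span b beta U `&` lattice_coset L h)
        (C j U)) :
  let Red := Omega_red b L B beta `&` lattice_coset L h in
  [/\ forall g X, Gam g -> Red X -> Red (act_tuple g X),
      finite_set [set orbit_of Gam X | X in Red]
    & orbit_representatives Gam Red
        (\bigcup_j \bigcup_(U in spans_at b L h beta (ell j))
           (C j U `&` Omega_red b L B beta))].
Proof.
have n_gt0 : (0 < n)%N by case/andP: n_bounds.
have [beta_sym _] := beta_psd.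
split.
- exact: Red_act.
- exact: (finite_orbits dimV b_nondeg b_sign L_lattice L_dual n_gt0 h_dual
    B_component Gam_group Gam_stab Gam_trivial beta_sym beta_rank Gam_index
    ell_repr).
- exact: (reps_orbit_representatives dimV b_nondeg b_sign L_lattice L_dual n_gt0
    h_dual B_component Gam_group Gam_stab Gam_trivial beta_sym beta_rank Gam_neat
    ell_isotropic ell_repr C_repr).
Qed.
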